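(* Let $R\ge 2$, $\alpha\in(0,1]$, let $\mu$ be an $\alpha$-dense piece of $\gamma_R$, and write $S:=\log(2/\alpha)$. Let $q$ be an integer and $K,Q$ with $Q$ a positive integer, and assume $3\le q\le K$ and $Q\ge RK\sqrt n$. Set $\lambda_q:=\frac{q-1}{q-2}$. Then there exist $t_1,\dots,t_m\in\mathbb T^n$ and integers $1\le k_1,\dots,k_m\le Q$ such that $m\le 14S$, $\prod_{j=1}^m k_j\le q^{56S(1+\log_K Q)}$, for every $j\in[m]$ there exist integers $0\le c_i<k_i$ ($i<j$) with $k_jt_j\equiv\sum_{i=1}^{j-1}c_it_i\pmod{\mathbb Z^n}$, and every $t\in\Lambda_K(\mu)$ admits integers $0\le c_i<k_i$ with $\left\|t-\sum_{i=1}^m c_it_i\right\|_{\mathbb T^n}\le \frac{5\lambda_q^{14S}\sqrt S}{R}$.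
   Context: $\log$ is base two. $\mathbb T^n=(\mathbb R/\mathbb Z)^n$ and $\|\zeta\|_{\mathbb T^n}$ is the Euclidean distance from (a representative of) $\zeta$ to $\mathbb Z^n$. For a probability measure $\mu$ on $\mathbb Z^n$, $\widehat\mu(\zeta)=\sum_{x}\mu(x)e^{-2\pi i\langle\zeta,x\rangle}$ for $\zeta\in\mathbb T^n$, and for $K\ge2$, $\Lambda_K(\mu)=\{\zeta\in\mathbb T^n:|\widehat\mu(\zeta)|\ge 1-1/K\}$. $\gamma_R(x)=e^{-\pi\|x\|_2^2/R^2}/\sum_{y\in\mathbb Z^n}e^{-\pi\|y\|_2^2/R^2}$. A probability measure $\mu$ is an $\alpha$-dense piece of $\nu$ if $\mu(x)\le\alpha^{-1}\nu(x)$ for all $x$. *)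

(* Defs.v *)
From HB Require Import structures.
From mathcomp Require Import all_boot all_order all_algebra.
From mathcomp Require Import generic_quotient ring_quotient.
From mathcomp Require Import all_classical all_reals all_analysis.
From mathcomp Require Import complex.

Set Implicit Arguments.
Unset Strict Implicit.
Unset Printing Implicit Defensive.

Import Order.TTheory GRing.Theory Num.Theory.

Local Open Scope classical_set_scope.
Local Open Scope complex_scope.
Local Open Scope ring_scope.

Definition logb (R : realType) (b x : R) : R := ln x / ln b.

(* Matrices in MathComp-Analysis carry the sup norm, hence an explicit
   Euclidean norm. *)
Definition norm2 (R : realType) (n : nat) (v : 'rV[R]_n) : R :=
  Num.sqrt (\sum_(i < n) v 0 i ^+ 2).

Definition dotv (R : realType) (n : nat) (u v : 'rV[R]_n) : R :=
  \sum_(i < n) u 0 i * v 0 i.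

Definition intv (R : realType) (n : nat) (x : 'rV[int]_n) : 'rV[R]_n :=
  map_mx intr x.

Definition int_lattice (R : realType) (n : nat) : {pred 'rV[R]_n} :=
  fun v => [forall i, v 0 i \is a Num.int].

Fact int_lattice_zmod (R : realType) (n : nat) : zmod_closed (@int_lattice R n).
Proof.
split=> [|u v /forallP u_int /forallP v_int]; apply/forallP => i.
  by rewrite mxE rpred0.
by rewrite !mxE rpredB.
Qed.

HB.instance Definition _ (R : realType) (n : nat) :=
  GRing.isZmodClosed.Build 'rV[R]_n (@int_lattice R n) (@int_lattice_zmod R n).

(* The additive group (R/Z)^n = R^n / Z^n; [repr] gives a representative in R^n
   and [\pi] is the projection from R^n. *)
Definition torus (R : realType) (n : nat) : Type :=
  {ideal_quot (@int_lattice R n)}.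

HB.instance Definition _ (R : realType) (n : nat) :=
  ZmodQuotient.on (torus R n).

Definition torus_norm (R : realType) (n : nat) (t : torus R n) : R :=
  inf [set norm2 (repr t - intv R x) | x in [set: 'rV[int]_n]].

(* Sum of an absolutely summable real (resp. complex) family; the value is
   meaningless if the family is not summable. *)
Definition rsum (R : realType) (T : choiceType) (f : T -> R) : R :=
  fine (\esum_(x in [set: T]) ((EFin \o f)^\+ x))%E
  - fine (\esum_(x in [set: T]) ((EFin \o f)^\- x))%E.

Definition csum (R : realType) (T : choiceType) (f : T -> R[i]) : R[i] :=
  rsum (fun x => complex.Re (f x)) +i* rsum (fun x => complex.Im (f x)).

Definition expi (R : realType) (a : R) : R[i] := cos a +i* sin a.

(* Probability measures on the countable set Z^n are given by their mass
   functions. *)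
Definition is_prob (R : realType) (n : nat) (mu : 'rV[int]_n -> R) : Prop :=
  (forall x, 0 <= mu x) /\
  (\esum_(x in [set: 'rV[int]_n]) (mu x)%:E = 1)%E.

(* The value does not depend on the representative of t, as x is integral. *)
Definition fourier (R : realType) (n : nat) (mu : 'rV[int]_n -> R)
    (t : torus R n) : R[i] :=
  csum (fun x => (mu x)%:C * expi (- (2 * pi * dotv (repr t) (intv R x)))).

Definition Lambda (R : realType) (n : nat) (K : R) (mu : 'rV[int]_n -> R) :
    set (torus R n) :=
  [set t | (1 - K^-1)%:C <= `|fourier mu t|].

Definition gauss_weight (R : realType) (n : nat) (r : R) (x : 'rV[int]_n) : R :=
  expR (- (pi * norm2 (intv R x) ^+ 2 / r ^+ 2)).

Definition gamma (R : realType) (n : nat) (r : R) (x : 'rV[int]_n) : R :=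
  gauss_weight r x / rsum (@gauss_weight R n r).

Definition dense_piece (R : realType) (n : nat) (alpha : R)
    (mu nu : 'rV[int]_n -> R) : Prop :=
  is_prob mu /\ forall x, mu x <= alpha^-1 * nu x.

(* Main.v *)
(** The elements sum_i c_i t_i with 0 <= c_i < k_i form a finite subgroup H of
    the torus, built greedily: while some s in Lambda_K(mu) is eps_m-far from H,
    take the least k >= q - 2 for which k s is close to H, perturb s to a t with
    k t in H, and adjoin t. Each step also records the frequencies
    s, q s, ..., q^(L-1) s with q^L <= k and q^(2L-1) <= K, along which mu is
    still concentrated because 1 - cos (m x) <= m^2 (1 - cos x). The recorded
    frequencies stay dissociated at scale eps_0 = 5 sqrt S / R, the radii growing
    by a factor lambda_q per step to absorb the perturbations.

    Dissociation bounds the number of recorded frequencies by 14 S: the Riesz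
    product prod (1 + cos(.) / 8) has mean at most 2 under the Gaussian, while
    its logarithm has large mean under mu, and mu <= gamma / alpha. This needs
    the dimension-free decay exp (- c R^2 |z|^2) of the Fourier transform of the
    discrete Gaussian, obtained from a finite Jacobi triple product: the Gaussian
    is a limit of product measures whose Fourier transforms are
    prod_i (1 + s_i e^(i theta)). *)
Require Import Defs.
From mathcomp Require Import all_boot all_order all_algebra.
From mathcomp Require Import generic_quotient ring_quotient.
From mathcomp Require Import all_classical all_reals all_analysis.
From mathcomp Require Import complex.
From mathcomp Require Import ring lra zify.

Set Implicit Arguments.
Unset Strict Implicit.
Unset Printing Implicit Defensive.

Import Order.TTheory GRing.Theory Num.Theory.
Import numFieldNormedType.Exports.
Local Open Scope classical_set_scope.
Local Open Scope quotient_scope.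
Local Open Scope complex_scope.
Local Open Scope ring_scope.

(** * Elementary bounds on sine, cosine and logarithm *)

(** Concavity through two mean values: if [sin x] were below the chord, the slope [cos c1] left of
    [x] would be under [2 / pi] and the slope [cos c2] right of [x] over it, while cosine
    decreases. *)
Lemma sin_ge_chord (R : realType) (x : R) :
  0 <= x <= pi / 2 -> 2 / pi * x <= sin x.
Proof.
have pi0 := @pi_gt0 R.
have pp : 2 / pi * (pi / 2) = 1 :> R.
  by rewrite mulf_div [2 * pi]mulrC divff// mulf_neq0// lt0r_neq0.
move=> /andP[]; rewrite le_eqVlt => /predU1P[<-|x0]; first by rewrite mulr0 sin0.
rewrite le_eqVlt => /predU1P[->|xp].
  by rewrite sin_pihalf pp.
have der (a b y : R) : y \in `]a, b[ -> is_derive y 1 (@sin R) (cos y).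
  by move=> _; exact: is_derive_sin.
have cont (a b : R) : {within `[a, b], continuous (@sin R)}.
  by apply: continuous_subspaceT; exact: continuous_sin.
have [c1] := MVT x0 (@der 0 x) (cont 0 x).
rewrite in_itv/= sin0 !subr0 => /andP[c10 c1x] s1.
have [c2] := MVT xp (@der x (pi / 2)) (cont x (pi / 2)).
rewrite in_itv/= sin_pihalf => /andP[c2x c2p] s2.
have c12 : cos c2 < cos c1.
  rewrite ltr_cos ?in_itv/=; first exact: lt_trans c1x c2x.
  - by apply/andP; split; lra.
  - by apply/andP; split; lra.
rewrite leNgt; apply/negP => sx.
have k1 : cos c1 < 2 / pi by rewrite -(ltr_pM2r x0) -s1.
have e : 2 / pi * (pi / 2 - x) = 1 - 2 / pi * x by rewrite mulrBr pp.
have : cos c2 * (pi / 2 - x) < 2 / pi * (pi / 2 - x).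
  by rewrite ltr_pM2r ?subr_gt0//; exact: lt_trans c12 k1.
rewrite -s2 e; lra.
Qed.

Lemma one_subr_cos2 (R : realType) (y : R) : 1 - cos (y *+ 2) = 2 * sin y ^+ 2.
Proof. by rewrite cos_mulr2n sin2cos2; lra. Qed.

Lemma one_subr_cos_ge (R : realType) (z : R) :
  `|z| <= 2^-1 -> 8 * z ^+ 2 <= 1 - cos (2 * pi * z).
Proof.
move=> z2; have pi0 := @pi_gt0 R.
have -> : 2 * pi * z = (pi * z) *+ 2 by rewrite -[RHS]mulr_natl mulrA.
rewrite one_subr_cos2.
have -> : sin (pi * z) ^+ 2 = sin (pi * `|z|) ^+ 2.
  by case: (ger0P z) => _ //; rewrite mulrN sinN sqrrN.
rewrite -(real_normK (num_real z)).
have : 2 * `|z| <= sin (pi * `|z|).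
  have := @sin_ge_chord R (pi * `|z|); rewrite mulrA divfK ?lt0r_neq0//; apply.
  by rewrite mulr_ge0 ?(ltW pi0)//= ler_pM2l.
have := normr_ge0 z; nra.
Qed.

Lemma norm_sin_mulrn (R : realType) (m : nat) (y : R) :
  `|sin (y *+ m)| <= m%:R * `|sin y|.
Proof.
elim: m => [|m IH]; first by rewrite mulr0n sin0 normr0 mul0r.
rewrite mulrS sinD (le_trans (ler_normD _ _))// !normrM -natr1 mulrDl mul1r addrC.
apply: lerD.
  apply: le_trans IH; rewrite -[leRHS]mul1r ler_wpM2r//; exact: cos_max.
by rewrite -[leRHS]mulr1 ler_wpM2l//; exact: cos_max.
Qed.

(** Half angles reduce this to [norm_sin_mulrn]. *)
Lemma one_subr_cos_mulrn (R : realType) (m : nat) (y : R) :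
  1 - cos (y *+ m) <= m%:R ^+ 2 * (1 - cos y).
Proof.
have e u : u = (u / 2) *+ 2 :> R by rewrite -mulr_natl; lra.
rewrite [X in cos X](_ : _ = (y / 2 *+ m) *+ 2); last first.
  by rewrite -mulrnA mulnC mulrnA -e.
rewrite [X in _ * (1 - cos X)]e !one_subr_cos2.
rewrite [leRHS]mulrCA ler_pM2l// -exprMn -[leLHS](real_normK (num_real _)).
rewrite -[leRHS](real_normK (num_real _)) lerXn2r ?nnegrE//.
by rewrite normrM [`|m%:R|]ger0_norm// norm_sin_mulrn.
Qed.

Lemma cosD_int (R : realType) (a : R) (k : int) : cos (a + 2 * pi * k%:~R) = cos a.
Proof.
have per n b : cos (b + 2 * pi * n%:R) = cos b :> R.
  rewrite -(periodicn (@cosD2pi R) n b); congr (cos (_ + _)).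
  by rewrite mulr_natl mulr_natr.
case: k => n; first exact: per.
by rewrite NegzE mulrNz mulrN -[in RHS](subrK (2 * pi * n.+1%:~R) a) per.
Qed.

(** From [ln (1 + u) <= u] at [u = (1 + y)^-1 - 1] comes [ln (1 + y) >= y / (1 + y) = y - y ^ 2 / (1
    + y)], and [1 + y >= 7 / 8]. *)
Lemma ln1D_ge (R : realType) (y : R) : `|y| <= 8^-1 -> y - 8 / 7 * y ^+ 2 <= ln (1 + y).
Proof.
rewrite ler_norml => /andP[y1 y2]; have y0 : 0 < 1 + y by lra.
have := @le_ln1Dx R ((1 + y)^-1 - 1); rewrite [1 + (_ - _)]addrC subrK lnV//.
have -> : -1 < (1 + y)^-1 - 1 by rewrite ltrBrDl subrr invr_gt0.
move=> /(_ isT); rewrite lerNl => /(le_trans _); apply; rewrite opprB.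
have -> : 1 - (1 + y)^-1 = y / (1 + y) by field; rewrite lt0r_neq0.
by rewrite ler_pdivlMr//; nra.
Qed.

Lemma ln2_le (R : realType) : ln 2 <= 4 / 5 :> R.
Proof.
rewrite -ler_expR lnK ?posrE//.
(* [expR (4 / 15) >= 19 / 15], whose cube is just above 2. *)
have -> : 4 / 5 = 3%:R * (4 / 15) :> R by lra.
rewrite expRM_natl; have := @expR_ge1Dx R (4 / 15).
move: (expR _) => e e1; have e0 : 0 <= 19 / 15 :> R by lra.
have : (19 / 15) ^+ 3 <= e ^+ 3 by rewrite lerXn2r ?nnegrE//; lra.
by apply: le_trans; rewrite !exprS expr0; lra.
Qed.

(** * A finite Jacobi triple product *)

(** The q-Pochhammer product [(- y X; P)_M]; its coefficients are q-binomial coefficients times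
    [y ^ j P ^ (j (j - 1) / 2)]. *)
Definition qpoly (R : comNzRingType) (P y : R) (M : nat) : {poly R} :=
  \prod_(i < M) (1 + (y * P ^+ i) *: 'X).

Lemma qpolyS (R : comNzRingType) (P y : R) (M : nat) :
  qpoly P y M.+1 = qpoly P y M * (1 + (y * P ^+ M) *: 'X).
Proof. by rewrite /qpoly big_ord_recr. Qed.

Lemma coef_qpolyS (R : comNzRingType) (P y : R) (M j : nat) :
  (qpoly P y M.+1)`_j.+1 = (qpoly P y M)`_j.+1 + y * P ^+ M * (qpoly P y M)`_j.
Proof. by rewrite qpolyS mulrDr mulr1 coefD -scalerAr coefZ coefMX. Qed.

Lemma coef0_qpoly (R : comNzRingType) (P y : R) (M : nat) : (qpoly P y M)`_0 = 1.
Proof.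
elim: M => [|M IH]; first by rewrite /qpoly big_ord0 coef1.
by rewrite qpolyS mulrDr mulr1 coefD -scalerAr coefZ coefMX mulr0 addr0.
Qed.

(* With [P = p ^ 2], [M = 2 N] and [y = p / P ^ N], these ratios say that the
   coefficient of index [N + k] is [p ^ (k ^ 2)] times the central one, up to
   factors tending to 1 with [N]: a finite form of the Jacobi triple product. *)
Lemma coef_qpoly_ratio (R : comNzRingType) (P y : R) (M j : nat) :
  (qpoly P y M)`_j.+1 * (1 - P ^+ j.+1) = y * (P ^+ j - P ^+ M) * (qpoly P y M)`_j.
Proof.
elim: M j => [|M IH] j.
  rewrite /qpoly big_ord0 !coef1 mul0r.
  by case: j => [|j]; rewrite ?expr0 ?subrr ?mulr0 ?mul0r.
rewrite coef_qpolyS mulrDl IH; case: j => [|j].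
  by rewrite !coef0_qpoly !expr0 !expr1 exprS; ring.
have := IH j; rewrite coef_qpolyS !exprS; set a := _`_j.+1; set b := _`_j.
(* The induction hypothesis at the upper index is already used; what remains is a multiple of the
   hypothesis at [j]. *)
move=> e; apply/eqP; rewrite -subr_eq0; apply/eqP.
transitivity (y * P * P ^+ M * (a * (1 - P * P ^+ j) - y * (P ^+ j - P ^+ M) * b)).
  by ring.
by rewrite e subrr mulr0.
Qed.

Lemma size_qpoly_le (R : comNzRingType) (P y : R) (M : nat) :
  (size (qpoly P y M) <= M.+1)%N.
Proof.
elim: M => [|M IH]; first by rewrite /qpoly big_ord0 size_poly1.
rewrite qpolyS mulrDr mulr1 -scalerAr.
apply: leq_trans (size_polyD _ _) _; rewrite geq_max (leq_trans IH)//=.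
apply: leq_trans (size_scale_leq _ _) _.
by apply: leq_trans (size_polyMleq _ _) _; rewrite size_polyX addn2.
Qed.

Lemma coef_qpoly_gt0 (R : realFieldType) (P y : R) (M j : nat) :
  0 < P < 1 -> 0 < y -> (j <= M)%N -> 0 < (qpoly P y M)`_j.
Proof.
move=> /andP[P0 P1] y0; elim: j => [|j IH] jM; first by rewrite coef0_qpoly.
have Pj : 0 < 1 - P ^+ j.+1 by rewrite subr_gt0 exprn_ilt1// ltW.
rewrite -(pmulr_lgt0 _ Pj) coef_qpoly_ratio !mulr_gt0 ?IH ?(ltnW jM)//.
by rewrite subr_gt0 ltr_iXn2l.
Qed.

(** Iterate the ratio, using [(k + 1) ^ 2 = k ^ 2 + 2 k + 1]. With [P = p ^ 2], the quotient of the
    two correction factors is at most 1, and at least [1 - P ^ (N - k0)] for [k < k0]. *)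
Lemma gauss_ratio_bounds (R : realFieldType) (p : R) (N k0 : nat) (a : nat -> R) :
  0 < p < 1 -> (k0 <= N)%N -> a 0%N = 1 ->
  (forall k, (k < N)%N -> a k.+1 * (1 - (p ^+ 2) ^+ (N + k).+1)
     = a k * p ^+ k.*2.+1 * (1 - (p ^+ 2) ^+ (N - k))) ->
  (forall k, (k <= N)%N -> 0 <= a k <= p ^+ (k * k)) /\
  (forall k, (k <= k0)%N -> p ^+ (k * k) * (1 - (p ^+ 2) ^+ (N - k0)) ^+ k <= a k).
Proof.
move=> /andP[p0 p1] k0N a0 aS.
have P0 : 0 < p ^+ 2 by rewrite exprn_gt0.
have P1 : p ^+ 2 < 1 by rewrite exprn_ilt1// ltW.
have pos k : 0 <= 1 - (p ^+ 2) ^+ k by rewrite subr_ge0 exprn_ile1// ltW.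
have posS k : 0 < 1 - (p ^+ 2) ^+ k.+1 by rewrite subr_gt0 exprn_ilt1// ltW.
have pE k : p ^+ (k.+1 * k.+1) = p ^+ (k * k) * p ^+ k.*2.+1.
  by rewrite -exprD; congr (_ ^+ _); lia.
have aS' k : (k < N)%N -> a k.+1 = a k * p ^+ k.*2.+1 * ((1 - (p ^+ 2) ^+ (N - k)) / (1 - (p ^+ 2) ^+ (N + k).+1)).
  by move=> kN; rewrite mulrA -aS// mulfK// lt0r_neq0.
split; elim=> [|k IH] kN.
- by rewrite a0 mul0n expr0 ler01 lexx.
- have /andP[ak ak'] := IH (ltnW kN).
  rewrite aS'//; apply/andP; split.
    by rewrite !mulr_ge0 ?exprn_ge0 ?invr_ge0 ?(ltW p0)// ltW.
  rewrite -[leRHS]mulr1 pE ler_pM ?mulr_ge0 ?invr_ge0 ?exprn_ge0 ?(ltW p0) ?(ltW (posS _))//.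
    by rewrite ler_wpM2r// exprn_ge0// ltW.
  rewrite ler_pdivrMr// mul1r lerD2l lerN2 ler_wiXn2l ?(ltW P0) ?(ltW P1)//.
  by lia.
- by rewrite a0 mul0n expr0 mulr1.
- have kN' : (k < N)%N by lia.
  rewrite aS'// pE [_ ^+ k.+1]exprSr [leLHS]mulrACA -[leRHS]mulrA.
  rewrite ler_pM ?mulr_ge0 ?exprn_ge0 ?(ltW p0) ?IH ?(ltnW kN)//.
  rewrite ler_wpM2l ?exprn_ge0 ?(ltW p0)//.
  apply: (@le_trans _ _ (1 - (p ^+ 2) ^+ (N - k))).
    by rewrite lerD2l lerN2 ler_wiXn2l ?(ltW P0) ?(ltW P1)//; lia.
  by rewrite ler_pdivlMr// ler_piMr// gerBl exprn_ge0// ltW.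
Qed.

Section GaussApprox.
Variables (R : realType) (p : R) (N : nat).
Hypothesis p01 : 0 < p < 1.

Definition gauss_coef (j : nat) : R := (qpoly (p ^+ 2) (p / (p ^+ 2) ^+ N) (N + N))`_j.

Let p0 : 0 < p. Proof. by case/andP: p01. Qed.
Let P0 : 0 < p ^+ 2. Proof. by rewrite exprn_gt0. Qed.
Let P1 : p ^+ 2 < 1. Proof. by case/andP: p01 => *; rewrite exprn_ilt1// ltW. Qed.

Lemma gauss_coef_gt0 j : (j <= N + N)%N -> 0 < gauss_coef j.
Proof. by apply: coef_qpoly_gt0; rewrite ?P0 ?P1 ?divr_gt0 ?exprn_gt0. Qed.

Let ratio j : gauss_coef j.+1 * (1 - (p ^+ 2) ^+ j.+1)
  = p / (p ^+ 2) ^+ N * ((p ^+ 2) ^+ j - (p ^+ 2) ^+ (N + N)) * gauss_coef j.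
Proof. exact: coef_qpoly_ratio. Qed.

Lemma gauss_coef_right k : (k < N)%N ->
  gauss_coef (N + k.+1) * (1 - (p ^+ 2) ^+ (N + k).+1)
  = gauss_coef (N + k) * p ^+ k.*2.+1 * (1 - (p ^+ 2) ^+ (N - k)).
Proof.
move=> kN; rewrite addnS ratio.
have -> : (N + N = N + k + (N - k))%N by lia.
rewrite [(p ^+ 2) ^+ (N + k + _)]exprD exprD.
have -> : p ^+ k.*2.+1 = p * (p ^+ 2) ^+ k by rewrite -exprM mul2n exprS.
by field; rewrite lt0r_neq0 ?exprn_gt0.
Qed.

Lemma gauss_coef_left k : (k < N)%N ->
  gauss_coef (N - k.+1) * (1 - (p ^+ 2) ^+ (N + k).+1)
  = gauss_coef (N - k) * p ^+ k.*2.+1 * (1 - (p ^+ 2) ^+ (N - k)).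
Proof.
move=> kN; have := ratio (N - k.+1).
have -> : ((N - k.+1).+1 = N - k)%N by lia.
move=> rE; rewrite mulrAC rE.
have -> : (N + N = (N - k.+1) + (N + k).+1)%N by lia.
rewrite exprD.
have -> : (p ^+ 2) ^+ N = (p ^+ 2) ^+ k.+1 * (p ^+ 2) ^+ (N - k.+1).
  by rewrite -exprD; congr (_ ^+ _); lia.
have -> : p ^+ k.*2.+1 = (p ^+ 2) ^+ k.+1 / p.
  apply: (mulIf (lt0r_neq0 p0)); rewrite divfK ?lt0r_neq0// -exprSr -exprM.
  by congr (_ ^+ _); lia.
field.
by rewrite !lt0r_neq0 ?exprn_gt0.
Qed.

(** Divided by the central one, the coefficients right and left of the centre obey the same
    recurrence. *)
Lemma gauss_coef_bounds (k0 : nat) : (k0 <= N)%N ->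
  (forall k, (k <= N)%N -> gauss_coef (N + k) <= gauss_coef N * p ^+ (k * k)
    /\ gauss_coef (N - k) <= gauss_coef N * p ^+ (k * k)) /\
  (forall k, (k <= k0)%N ->
    let d := p ^+ (k * k) * (1 - (p ^+ 2) ^+ (N - k0)) ^+ k in
    gauss_coef N * d <= gauss_coef (N + k) /\ gauss_coef N * d <= gauss_coef (N - k)).
Proof.
move=> k0N; have eN : 0 < gauss_coef N by apply: gauss_coef_gt0; rewrite leq_addr.
have [] := @gauss_ratio_bounds R p N k0 (fun k => gauss_coef (N + k) / gauss_coef N) p01 k0N.
- by rewrite addn0 divff ?lt0r_neq0.
- by move=> k kN; rewrite mulrAC gauss_coef_right//; field; rewrite lt0r_neq0.
move=> ur lr.
have [] := @gauss_ratio_bounds R p N k0 (fun k => gauss_coef (N - k) / gauss_coef N) p01 k0N.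
- by rewrite subn0 divff ?lt0r_neq0.
- by move=> k kN; rewrite mulrAC gauss_coef_left//; field; rewrite lt0r_neq0.
move=> ul ll; split=> k kN; split.
- by rewrite mulrC -ler_pdivrMr//; case/andP: (ur k kN).
- by rewrite mulrC -ler_pdivrMr//; case/andP: (ul k kN).
- by rewrite mulrC -ler_pdivlMr//; exact: lr.
- by rewrite mulrC -ler_pdivlMr//; exact: ll.
Qed.

End GaussApprox.

(** * Fourier decay in one dimension *)

Lemma expiD (R : realType) (a b : R) : expi (a + b) = expi a * expi b.
Proof. by rewrite /expi cosD sinD; simpc; congr (_ +i* _); rewrite addrC. Qed.

Lemma expi0 (R : realType) : expi (0 : R) = 1.
Proof. by rewrite /expi cos0 sin0. Qed.

Lemma expi_sum (R : realType) (I : Type) (s : seq I) (f : I -> R) :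
  expi (\sum_(i <- s) f i) = \prod_(i <- s) expi (f i).
Proof. exact: (big_morph _ (@expiD R) (@expi0 R)). Qed.

Lemma expi_mulrn (R : realType) (a : R) (m : nat) : expi (a *+ m) = expi a ^+ m.
Proof.
by elim: m => [|m IH]; rewrite ?mulr0n ?expi0 ?expr0// mulrS expiD IH exprS.
Qed.

Lemma norm_expi (R : realType) (a : R) : `|expi a| = 1.
Proof. by rewrite normc_def /= cos2Dsin2 sqrtr1. Qed.

(** The squared modulus is [(1 + s) ^ 2 - 2 s (1 - cos a)]; factor out [(1 + s) ^ 2] and use
    [1 + x <= exp x]. *)
Lemma norm_1D_expi (R : realType) (s a : R) : 0 <= s ->
  `|1 + s%:C * expi a|
    <= ((1 + s) * expR (- ((1 - cos a) * (s / (1 + s) ^+ 2))))%:C.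
Proof.
move=> s0; have s1 : 0 < 1 + s by lra.
rewrite normc_def lecR -[leRHS]ger0_norm ?mulr_ge0 ?expR_ge0 ?(ltW s1)//.
rewrite -sqrtr_sqr ler_wsqrtr//= !mul0r subr0 addr0 add0r [leRHS]exprMn.
rewrite -[expR _ ^+ 2]expRM_natl.
have := cos2Dsin2 a; move: (cos a) (sin a) => c d cd.
set E := (X in expR X); have := expR_ge1Dx E.
have eE : (1 + s) ^+ 2 * (1 + E) = (1 + s) ^+ 2 - 2 * (1 - c) * s.
  by rewrite /E; field; rewrite lt0r_neq0.
move=> h; apply: (@le_trans _ _ ((1 + s) ^+ 2 * (1 + E))).
  by rewrite eE; nra.
by rewrite ler_wpM2l// sqr_ge0.
Qed.

Lemma norm_1D_expi_le (R : realType) (s a : R) : 0 <= s ->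
  `|1 + s%:C * expi a| <= (1 + s)%:C.
Proof.
move=> s0; apply: le_trans (ler_normD _ _) _.
by rewrite normrM norm_expi normr1 mulr1 normc_def/= expr0n/= addr0 sqrtr_sqr ger0_norm// rmorphD.
Qed.

Lemma horner_qpoly_expi (R : realType) (P y a : R) (M : nat) :
  \sum_(j < M.+1) ((qpoly P y M)`_j)%:C * expi (a *+ j)
    = \prod_(i < M) (1 + (y * P ^+ i)%:C * expi a).
Proof.
transitivity ((map_poly (real_complex R) (qpoly P y M)).[expi a]).
  rewrite (@horner_coef_wide _ M.+1) ?size_map_poly ?size_qpoly_le//.
  by apply: eq_bigr => j _; rewrite coef_map expi_mulrn.
rewrite /qpoly rmorph_prod horner_prod; apply: eq_bigr => i _.
by rewrite rmorphD rmorph1/= map_polyZ map_polyX !hornerE.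
Qed.

Lemma sum_qpoly (R : comNzRingType) (P y : R) (M : nat) :
  \sum_(j < M.+1) (qpoly P y M)`_j = \prod_(i < M) (1 + y * P ^+ i).
Proof.
transitivity ((qpoly P y M).[1]).
  rewrite (@horner_coef_wide _ M.+1) ?size_qpoly_le//.
  by apply: eq_bigr => j _; rewrite expr1n mulr1.
by rewrite /qpoly horner_prod; apply: eq_bigr => i _; rewrite !hornerE.
Qed.

Definition gauss_base (R : realType) (r : R) : R := expR (- (pi / r ^+ 2)).

Lemma gauss_base01 (R : realType) (r : R) : 0 < r -> 0 < gauss_base r < 1.
Proof.
by move=> r0; rewrite expR_gt0 expR_lt1 oppr_lt0 divr_gt0 ?pi_gt0 ?exprn_gt0.
Qed.

(** With [u = pi / r ^ 2 <= 1], the numerator is at least [(3 / 4) ^ 4 >= 5 / 16], the denominator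
    at most [2 u], and [r ^ 2 * u <= 4]. The quotient is the sum of the series [p * (p ^ 2) ^ i],
    which governs the decay. *)
Lemma gauss_base_geom (R : realType) (r : R) : 2 <= r ->
  5 / 128 * r ^+ 2 <= gauss_base r / (1 - gauss_base r ^+ 2).
Proof.
move=> r2; have r0 : 0 < r by lra.
have /andP[p0 p1] := gauss_base01 r0.
have rr : 4 <= r ^+ 2 by nra.
have rr0 : 0 < r ^+ 2 by lra.
have pi4 : (pi : R) <= 4.
  by have := pihalf_lt2 R; rewrite ltr_pdivrMr// -natrM => /ltW.
rewrite /gauss_base in p0 p1 *; set u := pi / r ^+ 2.
have u0 : 0 < u by rewrite divr_gt0// pi_gt0.
have u1 : u <= 1 by rewrite ler_pdivrMr// mul1r (le_trans pi4).
have ur : r ^+ 2 * u <= 4 by rewrite /u mulrC divfK ?lt0r_neq0.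
rewrite -/u in p0 p1; move: u u0 u1 ur p0 p1 => u u0 u1 ur p0 p1; clear pi4.
have pge : 5 / 16 <= expR (- u).
  rewrite (_ : - u = 4%:R * (- u / 4)); last by lra.
  rewrite expRM_natl; apply: le_trans (_ : (1 + - u / 4) ^+ 4 <= _).
    have : 3 / 4 <= 1 + - u / 4 by lra.
    move=> /(@lerXn2r R 4%N); rewrite !nnegrE; have -> : 0 <= 3 / 4 :> R by lra.
    have -> : 0 <= 1 + - u / 4 :> R by lra.
    by move=> /(_ isT isT); apply: le_trans; rewrite !exprS expr0; lra.
  by rewrite lerXn2r ?nnegrE ?expR_ge0 ?expR_ge1Dx//; lra.
have ple : 1 - expR (- u) ^+ 2 <= 2 * u.
  rewrite -expRM_natl; have := expR_ge1Dx (2%:R * - u); lra.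
have P1 : 0 < 1 - expR (- u) ^+ 2 by rewrite subr_gt0 exprn_ilt1// ltW.
rewrite ler_pdivlMr//.
move: (expR _) p0 p1 pge ple P1 => p p0 p1 pge ple P1.
apply: (@le_trans _ _ (5 / 128 * r ^+ 2 * (2 * u))); last by lra.
by apply: ler_wpM2l; lra.
Qed.

(** The transform is a product of [N + N] factors. The first half, with parameters above 1, is
    bounded trivially; a factor of the second half, with parameter [s = p * (p ^ 2) ^ i <= 1], saves
    [exp (- (1 - cos a) * s / 4)], and these [s] add up to order [r ^ 2]. *)
Lemma gauss_coef_decay (R : realType) (r z : R) (N : nat) :
  2 <= r -> `|z| <= 2^-1 -> (gauss_base r ^+ 2) ^+ N <= 10^-1 ->
  `|\sum_(j < (N + N).+1) (gauss_coef (gauss_base r) N j)%:C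
       * expi (2 * pi * (z * (j%:R - N%:R)))|
  <= ((\sum_(j < (N + N).+1) gauss_coef (gauss_base r) N j)
       * expR (- (7 / 100 * r ^+ 2 * z ^+ 2)))%:C.
Proof.
move=> r2 z2 pN; have r0 : 0 < r by lra.
have geom := gauss_base_geom r2.
have := gauss_base01 r0; set p := gauss_base r in geom pN *; move=> /andP[p0 p1].
have P0 : 0 < p ^+ 2 by rewrite exprn_gt0.
have P1 : 0 < 1 - p ^+ 2 by rewrite subr_gt0 exprn_ilt1// ltW.
have PN : 0 < (p ^+ 2) ^+ N by rewrite exprn_gt0.
pose y := p / (p ^+ 2) ^+ N; have y0 : 0 < y by rewrite divr_gt0.
pose a := 2 * pi * z.
rewrite [X in `|X|](_ : _ = expi (- a *+ N) * \prod_(i < N + N) (1 + (y * (p ^+ 2) ^+ i)%:C * expi a)); last first.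
  rewrite -horner_qpoly_expi mulr_sumr; apply: eq_bigr => j _.
  rewrite [RHS]mulrCA -expiD; congr (_ * expi _).
  by rewrite mulrA -/a mulrBr !mulr_natr mulNrn addrC.
rewrite normrM norm_expi mul1r normr_prod big_split_ord/=.
rewrite [X in (X * _)%:C]sum_qpoly -/y big_split_ord/=.
apply: (@le_trans _ _ ((\prod_(i < N) (1 + y * (p ^+ 2) ^+ i))%:C *
   (\prod_(i < N) ((1 + y * (p ^+ 2) ^+ (N + i)) * expR (- ((1 - cos a) * (p * (p ^+ 2) ^+ i / 4)))))%:C)).
  apply: ler_pM; rewrite ?prodr_ge0// rmorph_prod; apply: ler_prod => i _; rewrite normr_ge0/=.
    by rewrite norm_1D_expi_le// mulr_ge0 ?exprn_ge0 ?(ltW y0)// ltW.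
  have yE : y * (p ^+ 2) ^+ (N + i) = p * (p ^+ 2) ^+ i.
    by rewrite exprD mulrA divfK// lt0r_neq0.
  rewrite yE; set s := p * _.
  have s0 : 0 < s by rewrite mulr_gt0// exprn_gt0.
  have s1 : s <= 1 by rewrite mulr_ile1 ?exprn_ge0 ?(ltW p0) ?(ltW p1) ?exprn_ile1 ?(ltW P0)//; lra.
  apply: le_trans (norm_1D_expi _ (ltW s0)) _; rewrite lecR; apply: ler_wpM2l; first by lra.
  rewrite ler_expR lerN2 ler_wpM2l ?subr_ge0 ?cos_le1//.
  by rewrite ler_wpM2l ?(ltW s0)// lef_pV2 ?posrE//; [nra|rewrite exprn_gt0//; lra].
rewrite -rmorphM lecR big_split/= mulrA ler_wpM2l//.
  by rewrite mulr_ge0// prodr_ge0// => i _; rewrite addr_ge0// mulr_ge0 ?exprn_ge0 ?(ltW y0)// ltW.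
rewrite -expR_sum ler_expR sumrN lerN2 -mulr_sumr -mulr_suml -mulr_sumr.
have := one_subr_cos_ge z2; rewrite -/a; move: (1 - cos a) => C ge8.
have gE : \sum_(i < N) (p ^+ 2) ^+ i = (1 - (p ^+ 2) ^+ N) / (1 - p ^+ 2).
  move: (p ^+ 2) P1 => x x1; apply: (mulIf (lt0r_neq0 x1)).
  by rewrite divfK ?lt0r_neq0// -[RHS]opprB subrX1 -mulNr opprB mulrC.
rewrite gE.
(* [(9 / 10) * (5 / 128) / 4] exceeds [7 / 800]; the factor 8 of [one_subr_cos_ge] then yields
   [7 / 100]. *)
have h1 : 7 / 8 / 100 * r ^+ 2 <= p * ((1 - (p ^+ 2) ^+ N) / (1 - p ^+ 2)) / 4.
  rewrite [p * _]mulrCA.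
  move: geom; set g := p / _ => geom.
  have : 9 / 10 <= 1 - (p ^+ 2) ^+ N by lra.
  have := sqr_ge0 r; nra.
apply: (@le_trans _ _ ((8 * z ^+ 2) * (7 / 8 / 100 * r ^+ 2))); first by lra.
have := sqr_ge0 z; have := sqr_ge0 r => rr zz.
by apply: ler_pM; [lra|lra|exact: ge8|exact: h1].
Qed.

(** * The torus, its characters and its norm *)

Definition tpi (R : realType) (n : nat) (v : 'rV[R]_n) : torus R n :=
  \pi_(torus R n) v.

Lemma tpi_repr (R : realType) (n : nat) (t : torus R n) : tpi (repr t) = t.
Proof. exact: reprK. Qed.

Lemma tpiD (R : realType) (n : nat) (u v : 'rV[R]_n) : tpi (u + v) = tpi u + tpi v.
Proof. by rewrite /tpi !piE. Qed.

Lemma tpiN (R : realType) (n : nat) (v : 'rV[R]_n) : tpi (- v) = - tpi v.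
Proof. by rewrite /tpi !piE. Qed.

Lemma tpi0 (R : realType) (n : nat) : tpi (0 : 'rV[R]_n) = 0.
Proof. by rewrite /tpi !piE. Qed.

Lemma tpiB (R : realType) (n : nat) (u v : 'rV[R]_n) : tpi (u - v) = tpi u - tpi v.
Proof. by rewrite tpiD tpiN. Qed.

Lemma tpiMn (R : realType) (n m : nat) (v : 'rV[R]_n) : tpi (v *+ m) = tpi v *+ m.
Proof. by elim: m => [|m IH]; rewrite ?mulr0n ?tpi0// !mulrS tpiD IH. Qed.

Lemma tpi_intv (R : realType) (n : nat) (x : 'rV[int]_n) : tpi (intv R x) = 0.
Proof.
rewrite -tpi0; apply/eqP; rewrite /tpi -Quotient.idealrBE subr0.
by apply/forallP => i; rewrite mxE intr_int.
Qed.

Lemma tpi_inj_mod (R : realType) (n : nat) (u v : 'rV[R]_n) :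
  tpi u = tpi v -> exists x, u = v + intv R x.
Proof.
move=> /eqP; rewrite /tpi -Quotient.idealrBE => /forallP uv.
exists (\row_i Num.floor ((u - v) 0 i)); apply/rowP => i; rewrite !mxE.
by have := uv i; rewrite intrEfloor !mxE => /eqP ->; rewrite addrC subrK.
Qed.

Lemma dotvDl (R : realType) (n : nat) (u v w : 'rV[R]_n) :
  dotv (u + v) w = dotv u w + dotv v w.
Proof. by rewrite /dotv -big_split; apply: eq_bigr => i _; rewrite mxE mulrDl. Qed.

Lemma dotvNl (R : realType) (n : nat) (u w : 'rV[R]_n) : dotv (- u) w = - dotv u w.
Proof. by rewrite /dotv -sumrN; apply: eq_bigr => i _; rewrite mxE mulNr. Qed.

Lemma dotv_intv (R : realType) (n : nat) (x y : 'rV[int]_n) :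
  dotv (intv R x) (intv R y) = (\sum_i x 0 i * y 0 i)%:~R.
Proof.
by rewrite /dotv rmorph_sum; apply: eq_bigr => i _; rewrite !mxE rmorphM.
Qed.

(** A real character with a free phase: by [waveM] products stay combinations of such functions, and
    the phase can absorb the argument of a Fourier coefficient. *)
Definition wave (R : realType) (n : nat) (phi : R) (t : torus R n) (x : 'rV[int]_n) : R :=
  cos (2 * pi * dotv (repr t) (intv R x) + phi).

Lemma wave_tpi (R : realType) (n : nat) (phi : R) (v : 'rV[R]_n) x :
  wave phi (tpi v) x = cos (2 * pi * dotv v (intv R x) + phi).
Proof.
rewrite /wave; have [y ->] := tpi_inj_mod (tpi_repr (tpi v)).
by rewrite dotvDl dotv_intv mulrDr addrAC cosD_int.
Qed.

Lemma waveM (R : realType) (n : nat) (phi psi : R) (t u : torus R n) x :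
  wave phi t x * wave psi u x
  = 2^-1 * (wave (phi + psi) (t + u) x + wave (phi - psi) (t - u) x).
Proof.
rewrite -[t]tpi_repr -[u]tpi_repr -tpiD -tpiB !wave_tpi dotvDl dotvDl dotvNl.
move: (2 * pi) => w; rewrite [w * (_ + _)]mulrDr [w * (_ - _)]mulrBr.
move: (w * _) (w * _) => b a.
rewrite (_ : a + b + (phi + psi) = (a + phi) + (b + psi)); last by ring.
rewrite (_ : a - b + (phi - psi) = (a + phi) - (b + psi)); last by ring.
by move: (a + phi) (b + psi) => c d; rewrite cosD cosB; lra.
Qed.

Lemma wave_mulrn (R : realType) (n m : nat) (phi : R) (t : torus R n) x :
  wave (phi *+ m) (t *+ m) x = cos ((2 * pi * dotv (repr t) (intv R x) + phi) *+ m).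
Proof.
rewrite -{1}[t]tpi_repr -tpiMn wave_tpi mulrnDl; congr (cos (_ + _)).
rewrite -mulrnAr; congr (_ * _); rewrite /dotv -sumrMnl; apply: eq_bigr => i _.
by rewrite mulmxnE mulrnAl.
Qed.

Lemma wave_le1 (R : realType) (n : nat) (phi : R) (t : torus R n) x : `|wave phi t x| <= 1.
Proof. exact: cos_max. Qed.

Lemma norm2_ge0 (R : realType) (n : nat) (v : 'rV[R]_n) : 0 <= norm2 v.
Proof. exact: sqrtr_ge0. Qed.

Lemma sqr_norm2 (R : realType) (n : nat) (v : 'rV[R]_n) :
  norm2 v ^+ 2 = \sum_i v 0 i ^+ 2.
Proof. by rewrite sqr_sqrtr// sumr_ge0// => i _; exact: sqr_ge0. Qed.

Lemma norm2_le (R : realType) (n : nat) (v : 'rV[R]_n) (b : R) :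
  0 <= b -> \sum_i v 0 i ^+ 2 <= b ^+ 2 -> norm2 v <= b.
Proof. by move=> b0 h; rewrite -[b]ger0_norm// -sqrtr_sqr ler_wsqrtr. Qed.

Lemma norm2_le_coord (R : realType) (n : nat) (u v : 'rV[R]_n) :
  (forall i, `|u 0 i| <= `|v 0 i|) -> norm2 u <= norm2 v.
Proof.
move=> uv; rewrite ler_wsqrtr// ler_sum// => i _.
by rewrite -(real_normK (num_real (u 0 i))) -(real_normK (num_real (v 0 i))) lerXn2r ?nnegrE.
Qed.

Lemma dotv_le (R : realType) (n : nat) (u v : 'rV[R]_n) : dotv u v <= norm2 u * norm2 v.
Proof.
have nu := norm2_ge0 u; have nv := norm2_ge0 v.
have zero (w z : 'rV[R]_n) : norm2 w = 0 -> dotv w z = 0.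
  move=> w0; have := sqr_norm2 w; rewrite w0 expr0n/= => /esym/eqP.
  rewrite psumr_eq0; last by move=> i _; exact: sqr_ge0.
  move=> /allP w0'; apply: big1 => i _; have := w0' i (mem_index_enum _).
  by rewrite sqrf_eq0 => /eqP ->; rewrite mul0r.
have [/eqP u0|u0] := boolP (norm2 u == 0); first by rewrite zero// u0 mul0r.
have [/eqP v0|v0] := boolP (norm2 v == 0).
  have -> : dotv u v = dotv v u by apply: eq_bigr => i _; rewrite mulrC.
  by rewrite zero// v0 mulr0.
have {}u0 : 0 < norm2 u by rewrite lt_neqAle eq_sym u0.
have {}v0 : 0 < norm2 v by rewrite lt_neqAle eq_sym v0.
(* Expanding gives [2 |u| |v| (|u| |v| - <u, v>)]; the degenerate cases were removed so that
   [|u| |v|] can be cancelled. *)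
have : 0 <= \sum_i (norm2 v * u 0 i - norm2 u * v 0 i) ^+ 2.
  by apply: sumr_ge0 => i _; exact: sqr_ge0.
have sq (a b c d : R) : (a * b - c * d) ^+ 2
    = a ^+ 2 * b ^+ 2 - 2 * a * c * (b * d) + c ^+ 2 * d ^+ 2 by ring.
under eq_bigr => i _ do rewrite sq.
rewrite big_split/= sumrB -!mulr_sumr -!sqr_norm2 -/(dotv u v).
move: (norm2 u) (norm2 v) u0 v0 (dotv u v) => a b a0 b0 d h.
have ab : 0 < a * b by rewrite mulr_gt0.
by rewrite -(ler_pM2l ab); nra.
Qed.

Lemma norm2D (R : realType) (n : nat) (u v : 'rV[R]_n) : norm2 (u + v) <= norm2 u + norm2 v.
Proof.
apply: norm2_le; first by rewrite addr_ge0 ?norm2_ge0.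
under eq_bigr => i _ do rewrite mxE sqrrD.
rewrite big_split/= big_split/= sqrrD !sqr_norm2 lerD2r lerD2l sumrMnl.
by rewrite ler_pMn2r//; exact: dotv_le.
Qed.

Lemma norm2Z (R : realType) (n : nat) (c : R) (v : 'rV[R]_n) : norm2 (c *: v) = `|c| * norm2 v.
Proof.
rewrite /norm2 -sqrtr_sqr -sqrtrM ?sqr_ge0// mulr_sumr; congr Num.sqrt.
by apply: eq_bigr => i _; rewrite mxE exprMn.
Qed.

Lemma norm2N (R : realType) (n : nat) (v : 'rV[R]_n) : norm2 (- v) = norm2 v.
Proof. by rewrite -scaleN1r norm2Z normrN1 mul1r. Qed.

Lemma nearest_int (R : realType) (a : R) :
  exists k : int, `|a - k%:~R| <= 2^-1 /\ forall l : int, `|a - k%:~R| <= `|a - l%:~R|.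
Proof.
pose k := Num.floor (a + 2^-1); exists k.
have k1 : k%:~R <= a + 2^-1 := floor_le_tmp _.
have k2 : a + 2^-1 < (k + 1)%:~R := floorD1_gt _.
rewrite rmorphD/= in k2.
have ak : `|a - k%:~R| <= 2^-1 by rewrite ler_norml; apply/andP; split; lra.
split=> // l; have [->//|lk] := eqVneq l k.
have : 1 <= `|k%:~R - l%:~R| :> R.
  by rewrite -rmorphB/= -intr_norm ler1z -gtz0_ge1 normr_gt0 subr_eq0 eq_sym//.
have := ler_normB (a - l%:~R) (a - k%:~R).
have -> : a - l%:~R - (a - k%:~R) = k%:~R - l%:~R by ring.
by move=> *; lra.
Qed.

(** Rounding minimises all coordinates at once, hence attains the infimum; the coordinate bound is
    what [one_subr_cos_ge] asks for. *)
Lemma torus_centered_repr (R : realType) (n : nat) (t : torus R n) :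
  exists v, [/\ tpi v = t, forall i, `|v 0 i| <= 2^-1 & norm2 v <= torus_norm t].
Proof.
have /choice[k kP] := fun i => nearest_int (repr t 0 i).
pose x : 'rV[int]_n := \row_i k i; exists (repr t - intv R x); split.
- by rewrite tpiB tpi_intv subr0 tpi_repr.
- by move=> i; rewrite !mxE; case: (kP i).
- apply: lb_le_inf; first by exists (norm2 (repr t - intv R 0)); exists 0.
  move=> _ [y _ <-]; apply: norm2_le_coord => i; rewrite !mxE.
  by case: (kP i).
Qed.

Lemma torus_norm_le (R : realType) (n : nat) (v : 'rV[R]_n) : torus_norm (tpi v) <= norm2 v.
Proof.
have [y yE] := tpi_inj_mod (tpi_repr (tpi v)).
apply: ge_inf; first by exists 0 => _ [z _ <-]; exact: norm2_ge0.
by exists y => //; rewrite yE addrK.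
Qed.

Lemma torus_norm_ge0 (R : realType) (n : nat) (t : torus R n) : 0 <= torus_norm t.
Proof.
by apply: lb_le_inf => [|_ [y _ <-]]; [exists (norm2 (repr t - intv R 0)); exists 0|exact: norm2_ge0].
Qed.

Lemma torus_normD (R : realType) (n : nat) (s t : torus R n) :
  torus_norm (s + t) <= torus_norm s + torus_norm t.
Proof.
have [u [<- _ us]] := torus_centered_repr s.
have [v [<- _ vt]] := torus_centered_repr t.
rewrite -tpiD; apply: le_trans (torus_norm_le _) _.
by apply: le_trans (norm2D _ _) _; exact: lerD.
Qed.

Lemma torus_normN (R : realType) (n : nat) (t : torus R n) : torus_norm (- t) = torus_norm t.
Proof.
have le (s : torus R n) : torus_norm (- s) <= torus_norm s.
  have [u [<- _ us]] := torus_centered_repr s.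
  by rewrite -tpiN; apply: le_trans (torus_norm_le _) _; rewrite norm2N.
by apply/eqP; rewrite eq_le le -{1}[t]opprK le.
Qed.

Lemma torus_norm0 (R : realType) (n : nat) : torus_norm (0 : torus R n) = 0.
Proof.
apply/eqP; rewrite eq_le torus_norm_ge0 andbT -tpi0.
by apply: le_trans (torus_norm_le _) _; rewrite -(scale0r (0 : 'rV[R]_n)) norm2Z normr0 mul0r.
Qed.

Lemma torus_norm_mulrn (R : realType) (n m : nat) (t : torus R n) :
  torus_norm (t *+ m) <= m%:R * torus_norm t.
Proof.
elim: m => [|m IH]; first by rewrite mulr0n torus_norm0 mul0r.
rewrite mulrSr -natr1 mulrDl mul1r; apply: le_trans (torus_normD _ _) _.
by rewrite lerD2r.
Qed.

Lemma torus_norm_ub (R : realType) (n : nat) (t : torus R n) :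
  torus_norm t <= Num.sqrt n%:R / 2.
Proof.
have [u [<- u2 _]] := torus_centered_repr t.
apply: le_trans (torus_norm_le _) _; apply: norm2_le.
  by rewrite divr_ge0// sqrtr_ge0.
rewrite exprMn sqr_sqrtr//.
apply: (@le_trans _ _ (\sum_(i < n) 2^-1 ^+ 2)).
  apply: ler_sum => i _; rewrite -(real_normK (num_real _)) lerXn2r ?nnegrE//.
by rewrite sumr_const card_ord mulr_natl.
Qed.

(** * Box weights approximating the Gaussian *)

(* [box_wt p] is a finitely supported minorant of the Gaussian weight (up to
   the factor [gauss_coef p N N ^+ n]) converging to it pointwise; unlike a
   truncation it has an exact product formula for its Fourier transform. *)
Definition box_pt (n N : nat) (w : {ffun 'I_n -> 'I_(N + N).+1}) : 'rV[int]_n :=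
  \row_i ((w i)%:Z - N%:Z).

Definition box_wt (R : realType) (p : R) (n N : nat) (w : {ffun 'I_n -> 'I_(N + N).+1}) : R :=
  \prod_i gauss_coef p N (w i).

Lemma Re_sum (R : realType) (I : Type) (s : seq I) (f : I -> R[i]) :
  complex.Re (\sum_(i <- s) f i) = \sum_(i <- s) complex.Re (f i).
Proof. by apply: (big_morph (@complex.Re R)) => // -[? ?] [? ?]. Qed.

(** The sum is the real part of [expi phi] times a transform that factors over the coordinates; the
    one-dimensional decays multiply to a decay in [norm2 v] with constants free of [n]. *)
Lemma box_decay (R : realType) (n N : nat) (r phi : R) (v : 'rV[R]_n) :
  2 <= r -> (forall i, `|v 0 i| <= 2^-1) -> (gauss_base r ^+ 2) ^+ N <= 10^-1 ->
  `|\sum_w box_wt (gauss_base r) w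
      * cos (2 * pi * dotv v (intv R (@box_pt n N w)) + phi)|
  <= (\sum_w @box_wt R (gauss_base r) n N w) * expR (- (7 / 100 * r ^+ 2 * norm2 v ^+ 2)).
Proof.
move=> r2 v2 pN; set p := gauss_base r.
pose Z : R[i] := expi phi * \sum_w (@box_wt R p n N w)%:C
     * expi (2 * pi * dotv v (intv R (box_pt w))).
have -> : \sum_w box_wt p w * cos (2 * pi * dotv v (intv R (@box_pt n N w)) + phi) = complex.Re Z.
  rewrite /Z mulr_sumr Re_sum; apply: eq_bigr => w _.
  by rewrite mulrCA -expiD addrC /expi /= mul0r subr0.
rewrite -lecR; apply: le_trans (normc_ge_Re _) _.
rewrite /Z normrM norm_expi mul1r.
have -> : \sum_w (@box_wt R p n N w)%:C * expi (2 * pi * dotv v (intv R (box_pt w)))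
  = \prod_i \sum_(j < (N + N).+1) (gauss_coef p N j)%:C
       * expi (2 * pi * (v 0 i * (j%:R - N%:R))).
  rewrite bigA_distr_bigA; apply: eq_bigr => w _.
  rewrite big_split/= /box_wt rmorph_prod; congr (_ * _).
  rewrite -expi_sum; congr expi; rewrite /dotv mulr_sumr.
  by apply: eq_bigr => i _; rewrite !mxE rmorphB.
rewrite normr_prod sqr_norm2 mulr_sumr -sumrN expR_sum.
rewrite /box_wt -(bigA_distr_bigA (fun _ (j : 'I_(N + N).+1) => gauss_coef p N j)).
rewrite -big_split/= rmorph_prod; apply: ler_prod => i _; rewrite normr_ge0/=.
exact: gauss_coef_decay.
Qed.

(** * Dissociated sequences and Riesz products *)

(* Only the first components matter here: the second ones are the phases of the
   factors of the Riesz product. *)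
Fixpoint cube (R : realType) (n : nat) (s : seq (torus R n * R)) (w : torus R n) : Prop :=
  if s is z :: s' then [\/ cube s' w, cube s' (w - z.1) | cube s' (w + z.1)]
  else w = 0.

(** Up to sign, the first nonzero coefficient of a combination with coefficients -1, 0, 1 is 1, so
    this bounds every nontrivial combination from below. *)
Fixpoint dissociated (R : realType) (n : nat) (eps : R) (s : seq (torus R n * R)) : Prop :=
  if s is z :: s' then
    dissociated eps s' /\ forall w, cube s' w -> eps <= torus_norm (z.1 + w)
  else True.

Definition riesz (R : realType) (n : nat) (s : seq (torus R n * R)) (x : 'rV[int]_n) : R :=
  \prod_(z <- s) (1 + 8^-1 * wave z.2 z.1 x).

Lemma riesz_cons (R : realType) (n : nat) z (s : seq (torus R n * R)) x :
  riesz (z :: s) x = riesz s x + 8^-1 * (riesz s x * wave z.2 z.1 x).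
Proof. by rewrite /riesz big_cons; move: (\prod_(_ <- _) _) (wave _ _ _) => a b; ring. Qed.

(** Peeling off one factor turns the mean at [t] into means at [t], [t + z.1], [t - z.1] with
    coefficients 1, 1/16, 1/16, of total 9/8; each frequency satisfies the hypothesis for the
    shorter sequence. *)
Lemma riesz_wave_mean (R : realType) (n : nat) (I : finType) (g : I -> R)
    (X : I -> 'rV[int]_n) (eps d : R) (s : seq (torus R n * R)) (phi : R) (t : torus R n) :
  (forall psi u, eps <= torus_norm u -> `|\sum_i g i * wave psi u (X i)| <= d) ->
  (forall w, cube s w -> eps <= torus_norm (t + w)) ->
  `|\sum_i g i * (riesz s (X i) * wave phi t (X i))| <= (9 / 8) ^+ size s * d.
Proof.
move=> dec; elim: s phi t => [|z s IH] phi t far /=.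
  rewrite expr0 mul1r; under eq_bigr => i _ do rewrite /riesz big_nil mul1r.
  by apply: dec; rewrite -[t]addr0; apply: far.
pose T psi u := \sum_i g i * (riesz s (X i) * wave psi u (X i)).
have -> : \sum_i g i * (riesz (z :: s) (X i) * wave phi t (X i))
  = T phi t + 16^-1 * T (phi + z.2) (t + z.1) + 16^-1 * T (phi - z.2) (t - z.1).
  rewrite /T !mulr_sumr -!big_split/=; apply: eq_bigr => i _.
  rewrite riesz_cons.
  have := waveM phi z.2 t z.1 (X i).
  move: (wave phi _ _) (wave z.2 _ _) (wave _ (t + _) _) (wave _ (t - _) _) => a b c e E.
  transitivity (g i * (riesz s (X i) * a + 8^-1 * (riesz s (X i) * (a * b)))); first by ring.
  by rewrite E; field.
have h1 : `|T phi t| <= (9 / 8) ^+ size s * d by apply: IH => w sw; apply: far; constructor 1.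
have h2 : `|T (phi + z.2) (t + z.1)| <= (9 / 8) ^+ size s * d.
  by apply: IH => w sw; rewrite -addrA; apply: far; constructor 2; rewrite [z.1 + w]addrC addrK.
have h3 : `|T (phi - z.2) (t - z.1)| <= (9 / 8) ^+ size s * d.
  by apply: IH => w sw; rewrite -addrA; apply: far; constructor 3; rewrite [- z.1 + w]addrC subrK.
apply: le_trans (ler_normD _ _) _; apply: le_trans (lerD (ler_normD _ _) (lexx _)) _.
have n16 : `|16^-1| = 16^-1 :> R by rewrite ger0_norm// invr_ge0 ler0n.
rewrite !normrM n16 exprS -mulrA.
move: (_ ^+ _ * d) (T _ _) (T _ _) (T _ _) h1 h2 h3 => c a b e; clear => h1 h2 h3.
by lra.
Qed.

(** A factor in front of a tail of length [j] adds at most [(1 / 8) (9 / 8) ^ j d], a geometric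
    sum. *)
Lemma riesz_mean (R : realType) (n : nat) (I : finType) (g : I -> R)
    (X : I -> 'rV[int]_n) (eps d : R) (s : seq (torus R n * R)) :
  (forall psi u, eps <= torus_norm u -> `|\sum_i g i * wave psi u (X i)| <= d) ->
  dissociated eps s ->
  \sum_i g i * riesz s (X i) <= \sum_i g i + ((9 / 8) ^+ size s - 1) * d.
Proof.
move=> dec; elim: s => [|z s IH] /=.
  move=> _; rewrite expr0 subrr mul0r addr0.
  by apply: ler_sum => i _; rewrite /riesz big_nil mulr1.
move=> [ds far]; under eq_bigr => i _ do rewrite riesz_cons mulrDr mulrCA.
rewrite big_split/= -mulr_sumr.
have := IH ds; have := riesz_wave_mean z.2 dec far.
move=> /(le_trans (ler_norm _)); rewrite exprS.
move: (_ ^+ _) (\sum_i _) (\sum_i _) (\sum_i _) => c a b e h1 h2.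
have -> : a + (9 / 8 * c - 1) * d = a + (c - 1) * d + 8^-1 * (c * d) by field.
by apply: lerD => //; apply: ler_wpM2l => //; lra.
Qed.

Lemma riesz_gt0 (R : realType) (n : nat) (s : seq (torus R n * R)) x : 0 < riesz s x.
Proof.
apply: prodr_gt0 => z _; have := wave_le1 z.2 z.1 x.
by rewrite ler_norml => /andP[]; lra.
Qed.

(** By [ln1D_ge] each factor loses at most [8 / 7 * (1 / 8) ^ 2 = 1 / 56]. *)
Lemma ln_riesz_ge (R : realType) (n : nat) (s : seq (torus R n * R)) x :
  \sum_(z <- s) (8^-1 * wave z.2 z.1 x - 56^-1) <= ln (riesz s x).
Proof.
elim: s => [|z s IH]; first by rewrite /riesz !big_nil ln1.
rewrite /riesz !big_cons -/(riesz s x) lnM ?posrE ?riesz_gt0//; last first.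
  have := wave_le1 z.2 z.1 x; by rewrite ler_norml => /andP[]; lra.
apply: lerD => //; have := wave_le1 z.2 z.1 x; move: (wave _ _ _) => c c1.
have := @ln1D_ge R (8^-1 * c).
have -> : `|8^-1 * c| <= 8^-1.
  by rewrite normrM ger0_norm; [rewrite -[leRHS]mulr1; apply: ler_wpM2l|]; lra.
move=> /(_ isT); apply: le_trans.
by move: c1; rewrite ler_norml => /andP[]; nra.
Qed.

(** * Infinite sums through finite ones, and the phase of a Fourier coefficient *)

Lemma esum_ge_seq (R : realType) (T : choiceType) (g : T -> R) (s : seq T) :
  uniq s -> ((\sum_(x <- s) g x)%:E <= \esum_(x in [set: T]) (g x)%:E)%E.
Proof.
move=> us; apply: esum_ge; exists [set` s]; first by split => //; exact: finite_seq.
by rewrite -fsbig_seq// sumEFin.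
Qed.

Lemma ler_sum_subset (R : numDomainType) (T : eqType) (f : T -> R) (s s' : seq T) :
  (forall x, 0 <= f x) -> uniq s -> uniq s' -> {subset s <= s'} ->
  \sum_(x <- s) f x <= \sum_(x <- s') f x.
Proof.
move=> f0 us us' ss'; rewrite [leRHS](bigID (mem s))/= -[leLHS]addr0.
apply: lerD; last by rewrite sumr_ge0.
rewrite -[leRHS]big_filter le_eqVlt; apply/orP; left; apply/eqP.
apply: perm_big; apply: uniq_perm; rewrite ?filter_uniq// => x.
by rewrite mem_filter/=; case xs: (x \in s) => //=; rewrite ss'.
Qed.

(** Quantifying over all sequences beyond [s0] lets several limits be taken along one common
    sequence. *)
Lemma esum_approx (R : realType) (T : choiceType) (g : T -> R) (c eta : R) :
  (forall x, 0 <= g x) -> (\esum_(x in [set: T]) (g x)%:E = c%:E)%E -> 0 < eta ->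
  exists2 s0 : seq T, uniq s0 & forall s, uniq s -> {subset s0 <= s} ->
    c - eta <= \sum_(x <- s) g x <= c.
Proof.
move=> g0 gc eta0.
have : ((c - eta)%:E < \esum_(x in [set: T]) (g x)%:E)%E by rewrite gc lte_fin ltrBlDr ltrDl.
move=> /ereal_sup_gt[_ [A [finA _] <-]].
rewrite (fsbig_finite _ _ finA)/= sumEFin lte_fin => hA.
exists (finmap.enum_fset (fset_set A)); first exact: finmap.fset_uniq.
have := finmap.fset_uniq (fset_set A).
move: (finmap.enum_fset _) hA => sA hA usA s us As; apply/andP; split; last first.
  by rewrite -lee_fin -gc; exact: esum_ge_seq.
apply: le_trans (ltW hA) _.
exact: ler_sum_subset.
Qed.

Lemma rsum_approx (R : realType) (T : choiceType) (f m : T -> R) (eta : R) :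
  (forall x, `|f x| <= m x) -> (\esum_(x in [set: T]) (m x)%:E < +oo)%E -> 0 < eta ->
  exists2 s0 : seq T, uniq s0 & forall s, uniq s -> {subset s0 <= s} ->
    `|\sum_(x <- s) f x - rsum f| <= eta.
Proof.
move=> fm mfin eta0.
have part (g : T -> R) : (forall x, 0 <= g x <= m x) ->
    (\esum_(x in [set: T]) (g x)%:E = (fine (\esum_(x in [set: T]) (g x)%:E))%:E)%E.
  move=> gm; rewrite fineK// ge0_fin_numE; last first.
    by apply: esum_ge0 => x _; rewrite lee_fin; case/andP: (gm x).
  apply: le_lt_trans mfin; apply: le_esum => x _; rewrite lee_fin.
  by case/andP: (gm x).
pose fp x := Num.max (f x) 0; pose fn x := Num.max (- f x) 0.
have fpm x : 0 <= fp x <= m x.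
  by rewrite le_max lexx orbT/= ge_max (le_trans (ler_norm _) (fm x)) (le_trans _ (fm x)).
have fnm x : 0 <= fn x <= m x.
  by rewrite le_max lexx orbT/= ge_max (le_trans _ (fm x)) ?(le_trans _ (fm x))// -normrN ler_norm.
have fE x : f x = fp x - fn x.
  rewrite /fp /fn; case: (leP (f x) 0) => h.
    by rewrite max_l ?oppr_ge0// sub0r opprK.
  by rewrite max_r ?subr0// oppr_le0 ltW.
have rE : rsum f = fine (\esum_(x in [set: T]) (fp x)%:E)%E - fine (\esum_(x in [set: T]) (fn x)%:E)%E.
  rewrite /rsum; congr (fine _ - fine _); apply: eq_esum => x _.
    by rewrite funeposE EFin_max.
  by rewrite funenegE EFin_max.
have eta2 : 0 < eta / 2 by lra.
have [s1 us1 h1] := esum_approx (fun x => proj1 (andP (fpm x))) (part _ fpm) eta2.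
have [s2 us2 h2] := esum_approx (fun x => proj1 (andP (fnm x))) (part _ fnm) eta2.
exists (undup (s1 ++ s2)); first exact: undup_uniq.
move=> s us sub.
have s1s : {subset s1 <= s} by move=> x xs; apply: sub; rewrite mem_undup mem_cat xs.
have s2s : {subset s2 <= s} by move=> x xs; apply: sub; rewrite mem_undup mem_cat xs orbT.
have /andP[a1 a2] := h1 s us s1s; have /andP[b1 b2] := h2 s us s2s.
under eq_bigr => x _ do rewrite fE.
rewrite sumrB rE ler_norml.
move: (fine _) (fine _) (\sum_(_ <- _) _) (\sum_(_ <- _) _) a1 a2 b1 b2 => p1 p2 p3 p4 a1 a2 b1 b2.
by apply/andP; split; lra.
Qed.

(** Polar coordinates of [(a, b)]: [acos] fixes the angle up to sign, and the sign of [b]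
    decides. *)
Lemma phase_exists (R : realType) (a b : R) :
  exists phi, a * cos phi + b * sin phi = Num.sqrt (a ^+ 2 + b ^+ 2).
Proof.
set D := Num.sqrt _.
have D0 : 0 <= D by exact: sqrtr_ge0.
have D2 : D ^+ 2 = a ^+ 2 + b ^+ 2 by rewrite sqr_sqrtr// addr_ge0 ?sqr_ge0.
have [/eqP Dz|Dz] := boolP (D == 0).
  exists 0; rewrite cos0 sin0 mulr1 mulr0 addr0 Dz.
  by apply/eqP; rewrite -sqrf_eq0; apply/eqP; have := sqr_ge0 a; have := sqr_ge0 b; rewrite Dz in D2; nra.
have {}D0 : 0 < D by rewrite lt_neqAle eq_sym Dz.
have c1 : -1 <= a / D <= 1.
  by rewrite ler_pdivlMr// ler_pdivrMr// mulN1r mul1r; apply/andP; split; have := sqr_ge0 b; nra.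
have cE : cos (acos (a / D)) = a / D by rewrite acosK// in_itv.
have sE : sin (acos (a / D)) = `|b| / D.
  rewrite sin_acos// (_ : 1 - _ = (`|b| / D) ^+ 2).
    by rewrite sqrtr_sqr ger0_norm// divr_ge0// ltW.
  by rewrite !exprMn real_normK ?num_real// exprVn D2; field; rewrite -D2 sqrf_eq0.
case: (leP 0 b) => b0.
  exists (acos (a / D)); rewrite cE sE ger0_norm//.
  by rewrite !mulrA -mulrDl -!expr2 -D2 expr2 mulfK.
exists (- acos (a / D)); rewrite cosN sinN cE sE ltr0_norm// mulNr opprK.
by rewrite !mulrA -mulrDl -!expr2 -D2 expr2 mulfK.
Qed.

(** The phase rotates the Fourier coefficient onto the positive axis, so the full mean of [1 - wave]
    is [1 - |fourier mu t| <= 1 / K]. The terms are nonnegative, so each finite part obeys the same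
    bound. *)
Lemma Lambda_phase (R : realType) (n : nat) (mu : 'rV[int]_n -> R) (K : R) (t : torus R n) :
  is_prob mu -> Lambda K mu t ->
  exists phi, forall s, uniq s -> \sum_(x <- s) mu x * (1 - wave phi t x) <= K^-1.
Proof.
move=> [mu0 mu1]; rewrite /Lambda/= /fourier /csum normc_def lecR/=.
set f1 := (X in rsum X ^+ 2 + _); set f2 := (X in _ + rsum X ^+ 2).
have f1E x : f1 x = mu x * cos (2 * pi * dotv (repr t) (intv R x)).
  by rewrite /f1/= mul0r subr0 cosN.
have f2E x : f2 x = - (mu x * sin (2 * pi * dotv (repr t) (intv R x))).
  by rewrite /f2/= mul0r addr0 sinN mulrN.
have [phi <-] := phase_exists (rsum f1) (rsum f2) => hK; exists phi => s us.
have fin : (\esum_(x in [set: 'rV[int]_n]) (mu x)%:E < +oo)%E by rewrite mu1 ltry.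
have b1 x : `|f1 x| <= mu x.
  by rewrite f1E normrM ger0_norm// -[leRHS]mulr1 ler_wpM2l ?cos_max.
have b2 x : `|f2 x| <= mu x.
  by rewrite f2E normrN normrM ger0_norm// -[leRHS]mulr1 ler_wpM2l ?sin_max.
apply/ler_addgt0Pr => eta eta0; have eta2 : 0 < eta / 2 by lra.
have [s1 us1 h1] := rsum_approx b1 fin eta2.
have [s2 us2 h2] := rsum_approx b2 fin eta2.
pose s' := undup (s ++ s1 ++ s2).
have us' : uniq s' by exact: undup_uniq.
have {}h1 := h1 s' us' _; have {}h2 := h2 s' us' _.
have {}h1 : `|\sum_(x <- s') f1 x - rsum f1| <= eta / 2.
  by apply: h1 => x xs; rewrite mem_undup !mem_cat xs orbT.
have {}h2 : `|\sum_(x <- s') f2 x - rsum f2| <= eta / 2.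
  by apply: h2 => x xs; rewrite mem_undup !mem_cat xs !orbT.
apply: (@le_trans _ _ (\sum_(x <- s') mu x * (1 - wave phi t x))).
  have pos x : 0 <= mu x * (1 - wave phi t x).
    by rewrite mulr_ge0// subr_ge0 (le_trans (ler_norm _) (wave_le1 _ _ _)).
  apply: ler_sum_subset => // x xs.
  by rewrite mem_undup mem_cat xs.
have m1 : \sum_(x <- s') mu x <= 1 by rewrite -lee_fin -mu1; exact: esum_ge_seq.
have -> : \sum_(x <- s') mu x * (1 - wave phi t x)
   = \sum_(x <- s') mu x - (cos phi * \sum_(x <- s') f1 x + sin phi * \sum_(x <- s') f2 x).
  rewrite !mulr_sumr -big_split/= -sumrB; apply: eq_bigr => x _.
  by rewrite f1E f2E /wave cosD; move: (cos _) (sin _) (cos _) (sin _) => A B C D; ring.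
have := cos_max phi; have := sin_max phi.
move: (\sum_(_ <- _) _) (\sum_(_ <- _) _) (\sum_(_ <- _) _) (rsum f1) (rsum f2) (cos phi) (sin phi) (K^-1) m1 h1 h2 hK.
move=> F2 F1 M A B c d k m1 h1 h2 hK d1 c1.
have e1 : c * A - c * F1 <= eta / 2.
  rewrite -mulrBr; apply: le_trans (ler_norm _) _; rewrite normrM distrC.
  by rewrite -[leRHS]mul1r ler_pM.
have e2 : d * B - d * F2 <= eta / 2.
  rewrite -mulrBr; apply: le_trans (ler_norm _) _; rewrite normrM distrC.
  by rewrite -[leRHS]mul1r ler_pM.
by clear -m1 hK e1 e2; lra.
Qed.

(** * Comparison of the dense piece with box weights *)

Lemma gauss_weightE (R : realType) (n : nat) (r : R) (x : 'rV[int]_n) :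
  gauss_weight r x = \prod_i gauss_base r ^+ (`|x 0%R i| * `|x 0%R i|)%N.
Proof.
rewrite /gauss_weight sqr_norm2 mulrAC mulr_sumr -sumrN expR_sum.
apply: eq_bigr => i _; rewrite /gauss_base -expRM_natl mulrN; congr (expR (- _)).
rewrite mxE mulrC natrM natr_absz; congr (_ * _).
by rewrite intr_norm -expr2 real_normK ?num_real.
Qed.

Lemma gauss_coef_le (R : realType) (p : R) (N j : nat) :
  0 < p < 1 -> (j <= N + N)%N ->
  let k := `|j%:Z - N%:Z|%N in gauss_coef p N j <= gauss_coef p N N * p ^+ (k * k).
Proof.
move=> p01 jN; have [] := gauss_coef_bounds p01 (leq0n N).
move=> le _ /=; case: (leqP N j) => h.
  have -> : `|j%:Z - N%:Z|%N = (j - N)%N by lia.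
  by have [] := le (j - N)%N _; rewrite ?subnKC//; lia.
have -> : `|j%:Z - N%:Z|%N = (N - j)%N by lia.
by have [] := le (N - j)%N _; rewrite ?subKn ?(ltnW h)//; lia.
Qed.

Lemma gauss_coef_ge (R : realType) (p : R) (N k0 j : nat) :
  0 < p < 1 -> (k0 <= N)%N -> (j <= N + N)%N -> (`|j%:Z - N%:Z| <= k0)%N ->
  let k := `|j%:Z - N%:Z|%N in
  gauss_coef p N N * (p ^+ (k * k) * (1 - (p ^+ 2) ^+ (N - k0)) ^+ k0) <= gauss_coef p N j.
Proof.
move=> p01 k0N jN jk; have [] := gauss_coef_bounds p01 k0N.
move=> _ ge /=; have /andP[p0 p1] := p01.
have eN : 0 < gauss_coef p N N by apply: gauss_coef_gt0; rewrite ?leq_addr.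
set k := `|_|%N in jk *; set y := 1 - _.
have y0 : 0 <= y by rewrite subr_ge0 exprn_ile1 ?exprn_ile1 ?exprn_ge0 ?(ltW p0) ?(ltW p1).
have y1 : y <= 1 by rewrite gerBl !exprn_ge0 ?(ltW p0).
have step : gauss_coef p N N * (p ^+ (k * k) * y ^+ k0) <= gauss_coef p N N * (p ^+ (k * k) * y ^+ k).
  by rewrite ler_pM2l// ler_wpM2l ?exprn_ge0 ?(ltW p0)// ler_wiXn2l.
apply: le_trans step _; have [h1 h2] := ge k jk.
case: (leqP N j) => h.
  by have -> : j = (N + k)%N by rewrite /k; lia.
by have -> : j = (N - k)%N by rewrite /k; lia.
Qed.

Lemma box_wt_le (R : realType) (r : R) (n N : nat) (w : {ffun 'I_n -> 'I_(N + N).+1}) :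
  0 < r -> box_wt (gauss_base r) w
    <= gauss_coef (gauss_base r) N N ^+ n * gauss_weight r (box_pt w).
Proof.
move=> r0; have p01 := gauss_base01 r0.
have prodE (c : R) : c ^+ n = \prod_(i < n) c by rewrite prodr_const card_ord.
rewrite gauss_weightE prodE -big_split/=.
apply: ler_prod => i _; have iN : (w i <= N + N)%N by rewrite -ltnS.
rewrite mxE (ltW (gauss_coef_gt0 p01 iN))/=; exact: gauss_coef_le.
Qed.

Lemma box_wt_ge (R : realType) (r : R) (n N k0 : nat) (w : {ffun 'I_n -> 'I_(N + N).+1}) :
  0 < r -> (k0 <= N)%N -> (forall i, (`|box_pt w 0%R i| <= k0)%N) ->
  gauss_coef (gauss_base r) N N ^+ n * gauss_weight r (box_pt w)
    * (1 - (gauss_base r ^+ 2) ^+ (N - k0)) ^+ (k0 * n) <= box_wt (gauss_base r) w.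
Proof.
move=> r0 k0N wk; have p01 := gauss_base01 r0; have /andP[p0 p1] := p01.
have prodE (c : R) : c ^+ n = \prod_(i < n) c by rewrite prodr_const card_ord.
rewrite gauss_weightE exprM !prodE -!big_split/=.
apply: ler_prod => i _; have iN : (w i <= N + N)%N by rewrite -ltnS.
have := wk i; rewrite mxE => wki.
have y0 : 0 <= 1 - (gauss_base r ^+ 2) ^+ (N - k0).
  by rewrite subr_ge0 exprn_ile1 ?exprn_ile1 ?exprn_ge0 ?(ltW p0) ?(ltW p1).
rewrite -mulrA; apply/andP; split; last exact: gauss_coef_ge.
by rewrite !mulr_ge0 ?exprn_ge0 ?(ltW p0)// ltW// gauss_coef_gt0// leq_addr.
Qed.

Lemma box_pt_onto (n N : nat) (x : 'rV[int]_n) :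
  (forall i, (`|x 0%R i| <= N)%N) -> exists w, @box_pt n N w = x.
Proof.
move=> xN; exists [ffun i => inord (absz (x 0 i + N%:Z))]; apply/rowP => i.
by rewrite mxE ffunE inordK; have := xN i; lia.
Qed.

Lemma box_pt_inj (n N : nat) : injective (@box_pt n N).
Proof.
move=> u v /rowP uv; apply/ffunP => i; apply: val_inj.
by have := uv i; rewrite !mxE /=; lia.
Qed.

Lemma expr_one_subr_ge (R : realDomainType) (y : R) (m : nat) :
  0 <= y <= 1 -> 1 - m%:R * y <= (1 - y) ^+ m.
Proof.
move=> /andP[y0 y1]; elim: m => [|m IH]; first by rewrite mul0r subr0 expr0.
rewrite exprS -natr1; have m0 : 0 <= m%:R :> R by [].
have : (1 - y) * (1 - m%:R * y) <= (1 - y) * (1 - y) ^+ m by rewrite ler_wpM2l// subr_ge0.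
apply: le_trans; move: (m%:R) m0 => c c0; nra.
Qed.

Lemma expr_small (R : realType) (P c : R) : 0 <= P < 1 -> 0 < c ->
  exists M, forall m, (M <= m)%N -> P ^+ m <= c.
Proof.
move=> /andP[P0 P1] c0; have P1' : `|P| < 1 by rewrite ger0_norm.
have /cvgrPdist_lt /(_ c c0) [M _ hM] := cvg_expr P1'.
exists M => m Mm; have := hM m Mm; rewrite /= sub0r normrN ger0_norm ?exprn_ge0//.
exact: ltW.
Qed.

(** Positivity and finiteness both follow from [mu] having mass 1: an infinite sum would have [fine]
    equal to 0, and a zero normaliser would make [gamma], hence [mu], vanish since the inverse of 0
    is 0. *)
Lemma gauss_total (R : realType) (n : nat) (r alpha : R) (mu : 'rV[int]_n -> R) :
  dense_piece alpha mu (gamma r) ->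
  0 < rsum (@gauss_weight R n r) /\
  forall s : seq 'rV[int]_n, uniq s -> \sum_(x <- s) gauss_weight r x <= rsum (@gauss_weight R n r).
Proof.
move=> [[mu0 mu1] mug].
have w0 x : 0 < @gauss_weight R n r x by exact: expR_gt0.
have tE : rsum (@gauss_weight R n r) = fine (\esum_(x in [set: 'rV[int]_n]) (gauss_weight r x)%:E)%E.
  rewrite /rsum (@esum1 _ _ _ (_^\-)%E) ?subr0 => [|x _].
    congr fine; apply: eq_esum => x _; rewrite funeposE/= max_l// lee_fin ltW//.
  by rewrite funenegE/= max_r// lee_fin oppr_le0 ltW.
have e0 : (0 <= \esum_(x in [set: 'rV[int]_n]) (gauss_weight r x)%:E)%E.
  by apply: esum_ge0 => x _; rewrite lee_fin ltW.
have t0 : 0 < rsum (@gauss_weight R n r).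
  rewrite lt_neqAle eq_sym tE fine_ge0// andbT -tE; apply/negP => /eqP t0.
  have := mu1; rewrite esum1 => [/eqP|x _]; first by rewrite eqe eq_sym oner_eq0.
  congr EFin; apply/eqP; rewrite eq_le mu0 andbT.
  by apply: le_trans (mug x) _; rewrite /gamma t0 invr0 !mulr0.
split=> // s us; rewrite -lee_fin tE fineK; first exact: esum_ge_seq.
by move: t0 e0; rewrite tE; case: (\esum_(_ in _) _)%E => //=; rewrite ltxx.
Qed.

(** Coordinates on [F] are bounded by some [k0], so for large [N] Bernoulli's inequality keeps the
    correction factor above [1 - eta / 2], and [(1 + eta) (1 - eta / 2) >= 1]. *)
Lemma gauss_box_approx (R : realType) (n : nat) (r eta : R) (F : seq 'rV[int]_n) :
  0 < r -> 0 < eta <= 1 ->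
  exists N, (gauss_base r ^+ 2) ^+ N <= 10^-1 /\
    forall x, x \in F -> exists2 w, @box_pt n N w = x &
      gauss_coef (gauss_base r) N N ^+ n * gauss_weight r x
        <= (1 + eta) * box_wt (gauss_base r) w.
Proof.
move=> r0 /andP[eta0 eta1]; have /andP[p0 p1] := gauss_base01 r0.
pose k0 := (\max_(x <- F) \max_(i < n) `|x 0%R i|)%N.
have Fk x i : x \in F -> (`|x 0%R i| <= k0)%N.
  move=> xF; apply: (@leq_trans (\max_(j < n) `|x 0%R j|)%N).
    exact: (leq_bigmax (F := fun j => `|x 0%R j|%N)).
  exact: (leq_bigmax_seq (F := fun y : 'rV[int]_n => (\max_(j < n) `|y 0%R j|)%N)).
have P01 : 0 <= gauss_base r ^+ 2 < 1.
  by rewrite exprn_ge0 ?exprn_ilt1 ?(ltW p0).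
set P := gauss_base r ^+ 2 in P01 *; have /andP[P0 P1] := P01.
(* The successor keeps [c] positive when [m] is 0. *)
pose m := (k0 * n)%N; pose c := eta / 2 / m.+1%:R.
have c0 : 0 < c by rewrite !divr_gt0.
have [M1 h1] := expr_small P01 c0.
have ten : 0 < 10^-1 :> R by rewrite invr_gt0.
have [M2 h2] := expr_small P01 ten.
exists (M1 + M2 + k0)%N; split; first by apply: h2; lia.
move=> x xF; have kN : (k0 <= M1 + M2 + k0)%N by lia.
have [w wE] : exists w, @box_pt n (M1 + M2 + k0) w = x.
  by apply: box_pt_onto => i; apply: leq_trans (Fk x i xF) kN.
exists w => //; have wk i : (`|box_pt w 0%R i| <= k0)%N by rewrite wE Fk.
have ge := box_wt_ge r0 kN wk; rewrite wE -/m in ge.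
set y := (gauss_base r ^+ 2) ^+ _ in ge.
have yc : y <= c by apply: h1; rewrite addnK leq_addr.
have y0 : 0 <= y by rewrite exprn_ge0.
have y1 : y <= 1 by rewrite exprn_ile1// ltW.
have my : m%:R * y <= eta / 2.
  apply: (@le_trans _ _ (m.+1%:R * c)); last by rewrite /c mulrC divfK.
  by apply: ler_pM => //; rewrite ler_nat.
have := @expr_one_subr_ge R y m; rewrite y0 y1 => /(_ isT) by_.
set E := _ * gauss_weight r x in ge *.
have E0 : 0 <= E.
  rewrite mulr_ge0 ?expR_ge0// exprn_ge0// ltW// gauss_coef_gt0 ?leq_addr//.
  exact: gauss_base01.
apply: le_trans (_ : (1 + eta) * (E * (1 - y) ^+ m) <= _); last first.
  by apply: ler_wpM2l => //; lra.
move: ((1 - y) ^+ m) by_ E E0 {ge} => b by_ E E0.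
have b1 : 1 <= (1 + eta) * b.
  have : 1 - eta / 2 <= b by lra.
  by clear -eta0 eta1; nra.
by rewrite mulrCA -[leLHS]mulr1 ler_wpM2l.
Qed.

(** On [F], [mu] is at most [(1 + eta) / (alpha W)] times the box weight of total mass [W]; the
    Riesz product has box mean at most 2, as the decay outweighs the growth [(9 / 8) ^ size s]. *)
Lemma riesz_mass_le (R : realType) (n : nat) (r alpha eta eps : R) (mu : 'rV[int]_n -> R)
    (s : seq (torus R n * R)) (F : seq 'rV[int]_n) :
  2 <= r -> 0 < alpha -> dense_piece alpha mu (gamma r) -> 0 < eta <= 1 -> 0 <= eps ->
  dissociated eps s ->
  (9 / 8) ^+ size s * expR (- (7 / 100 * r ^+ 2 * eps ^+ 2)) <= 1 ->
  uniq F -> \sum_(x <- F) mu x * riesz s x <= (1 + eta) * (2 / alpha).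
Proof.
move=> r2 a0 dp eta01 eps0 ds small uF; have r0 : 0 < r by apply: lt_le_trans r2.
have eta0 : 0 < 1 + eta by case/andP: eta01 => e0 _; rewrite addr_gt0.
have p01 := gauss_base01 r0.
have [t0 tot] := gauss_total dp; have [[mu0 mu1] mug] := dp.
have [N [pN app]] := gauss_box_approx F r0 eta01.
pose g (w : {ffun 'I_n -> 'I_(N + N).+1}) := box_wt (gauss_base r) w.
have g0 w : 0 < g w.
  by apply: prodr_gt0 => i _; apply: gauss_coef_gt0 => //; rewrite -ltnS.
pose W := \sum_w g w.
set T := rsum _ in t0 tot mug; set EN := gauss_coef _ N N ^+ n in app.
have EN0 : 0 < EN by rewrite exprn_gt0// gauss_coef_gt0// leq_addr.
have W0 : 0 < W.
  rewrite /W (bigD1 [ffun=> ord0])//= ltr_wpDr ?sumr_ge0// => w _; exact: ltW.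
have WT : W <= EN * T.
  apply: (@le_trans _ _ (\sum_w EN * gauss_weight r (@box_pt n N w))).
    by apply: ler_sum => w _; exact: box_wt_le.
  rewrite -mulr_sumr ler_pM2l//.
  have := tot (map (@box_pt n N) (index_enum _)); rewrite big_map; apply.
  by rewrite map_inj_uniq ?index_enum_uniq//; exact: box_pt_inj.
pose d := expR (- (7 / 100 * r ^+ 2 * eps ^+ 2)).
have dec psi u : eps <= torus_norm u -> `|\sum_w g w * wave psi u (box_pt w)| <= W * d.
  have [v [<- v2 _]] := torus_centered_repr u => ev.
  under eq_bigr => w _ do rewrite wave_tpi.
  apply: le_trans (box_decay _ r2 v2 pN) _; rewrite ler_pM2l// ler_expR lerN2.
  have ev' := le_trans ev (torus_norm_le v).
  apply: ler_wpM2l; first by rewrite mulr_ge0 ?sqr_ge0// divr_ge0 ?ler0n.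
  by rewrite lerXn2r ?nnegrE ?norm2_ge0.
have rm := riesz_mean dec ds; rewrite -/W -/d in rm small.
have rm2 : \sum_w g w * riesz s (box_pt w) <= 2 * W.
  apply: le_trans rm _; have d0 : 0 < d by exact: expR_gt0.
  move: (_ ^+ _) small => c; clear -W0 d0 => small; nra.
pose q := alpha^-1 * (1 + eta) / W.
have q0 : 0 <= q by rewrite divr_ge0 ?mulr_ge0 ?invr_ge0 ?(ltW a0) ?(ltW eta0) ?(ltW W0).
have pt x w : x = box_pt w -> EN * gauss_weight r x <= (1 + eta) * g w -> mu x <= q * g w.
  move=> xE h; apply: le_trans (mug x) _; rewrite /gamma -/T /q -mulrA -mulrA.
  rewrite ler_pM2l ?invr_gt0// ler_pdivrMr//.
  rewrite -(ler_pM2l EN0); apply: le_trans h _.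
  rewrite [leRHS]mulrCA -!mulrA ler_pM2l//.
  by rewrite mulrCA -[leLHS]mulr1 ler_pM2l ?g0// ler_pdivlMl// mulr1.
(* Each [x] in [F] is charged to a box point; after exchanging the sums each box point is counted at
   most once, since [F] has no repetition. *)
apply: (@le_trans _ _ (\sum_(x <- F) \sum_w (box_pt w == x)%:R * (q * g w * riesz s (box_pt w)))).
  rewrite big_seq [leRHS]big_seq; apply: ler_sum => x xF.
  have [w wx wle] := app x xF.
  rewrite (bigD1 w)//= wx eqxx mul1r -[leLHS]addr0; apply: lerD.
    by rewrite ler_pM2r ?riesz_gt0//; exact: pt (esym wx) wle.
  apply: sumr_ge0 => u _; apply: mulr_ge0; first exact: ler0n.
  by apply: mulr_ge0; [apply: mulr_ge0 => //; exact: ltW|exact/ltW/riesz_gt0].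
rewrite exchange_big/=.
apply: (@le_trans _ _ (\sum_w q * (g w * riesz s (box_pt w)))).
  apply: ler_sum => w _; rewrite -mulr_suml [q * (_ * _)]mulrA -[leRHS]mul1r.
  apply: ler_wpM2r.
    by apply: mulr_ge0; [apply: mulr_ge0 => //; exact: ltW|exact/ltW/riesz_gt0].
  have -> : \sum_(x <- F) (box_pt w == x)%:R = (box_pt w \in F)%:R :> R.
    rewrite -natr_sum -(count_uniq_mem _ uF) -sum1_count [in RHS]big_mkcond/=.
    by congr (_%:R); apply: eq_bigr => x _; rewrite eq_sym; case: eqP.
  by rewrite -[leRHS]/(1%:R) ler_nat leq_b1.
rewrite -mulr_sumr; apply: le_trans (ler_wpM2l q0 rm2) _.
by rewrite /q le_eqVlt; apply/orP; left; apply/eqP; field; rewrite !lt0r_neq0.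
Qed.

(** * The size of a dissociated sequence *)

Lemma logb2_ge1 (R : realType) (alpha : R) : 0 < alpha -> alpha <= 1 ->
  1 <= logb 2 (2 / alpha).
Proof.
move=> a0 a1; rewrite /logb ler_pdivlMr ?ln_gt0 ?ltr1n// mul1r ler_ln ?posrE ?divr_gt0//.
by rewrite ler_pdivlMr// ler_piMr.
Qed.

(* Entropy comparison: [ln y <= ln A + y / A - 1] turns a bound on the mean of
   the Riesz product into a bound on the mean of its logarithm. *)
Lemma dissociated_size_gap (R : realType) (n : nat) (r alpha : R)
    (mu : 'rV[int]_n -> R) (s : seq (torus R n * R)) :
  2 <= r -> 0 < alpha -> alpha <= 1 -> dense_piece alpha mu (gamma r) ->
  let S := logb 2 (2 / alpha) in
  (forall z, z \in s -> forall F, uniq F ->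
     \sum_(x <- F) mu x * (1 - wave z.2 z.1 x) <= 3^-1) ->
  dissociated (5 * Num.sqrt S / r) s ->
  (size s)%:R <= 14 * S -> (size s)%:R <= 13 * S.
Proof.
(* Each frequency contributes more than 0.064 to the mean logarithm, and [13 * 0.064 > 0.83], while
   the upper bound is at most [0.8 * S + 0.02]. *)
have arith (c T l S : R) : 1 <= S -> 13 * S < c -> l <= 4 / 5 ->
    T <= S * l - 1 + 100^-1 + (1 + 100^-1) ->
    c * (8^-1 * (2 / 3 - 100^-1) - 56^-1) <= T -> False.
  move=> S1 cS l1 up low; have : S * l <= S * (4 / 5) by apply: ler_wpM2l => //; lra.
  by lra.
move=> r2 a0 a1 dp S near ds size14.
have S1 : 1 <= S := logb2_ge1 a0 a1.
have S0 : 0 <= S by exact: le_trans ler01 S1.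
have r0 : 0 < r by apply: lt_le_trans r2.
have eps0 : 0 <= 5 * Num.sqrt S / r by rewrite divr_ge0 ?mulr_ge0 ?sqrtr_ge0 ?(ltW r0).
(* Here the 5 in the radius matters: [7 / 100 * 5 ^ 2 = 14 / 8], so with [9 / 8 <= expR (1 / 8)] the
   decay cancels the growth over [14 * S] factors. *)
have small : (9 / 8) ^+ size s * expR (- (7 / 100 * r ^+ 2 * (5 * Num.sqrt S / r) ^+ 2)) <= 1.
  have -> : 7 / 100 * r ^+ 2 * (5 * Num.sqrt S / r) ^+ 2 = 7 / 4 * S.
    rewrite -[in RHS](sqr_sqrtr S0); move: (Num.sqrt S) => q; clear -r0.
    by field; rewrite lt0r_neq0.
  rewrite expRN ler_pdivrMr ?expR_gt0// mul1r.
  apply: (@le_trans _ _ (expR (8^-1) ^+ size s)).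
    rewrite lerXn2r ?nnegrE ?expR_ge0 ?divr_ge0//.
    by apply: le_trans (expR_ge1Dx _); rewrite le_eqVlt; apply/orP; left; apply/eqP; field.
  rewrite -expRM_natl ler_expR; move: (size s)%:R size14; clear => c c14; lra.
have eta0 : 0 < 100^-1 :> R by rewrite invr_gt0 ltr0n.
have eta1 : 0 < (100^-1 : R) <= 1 by rewrite eta0 invf_le1 ?ler1n ?ltr0n.
have [[mu0 mu1] _] := dp.
have [F uF /(_ F uF)] := esum_approx mu0 mu1 eta0.
move=> /(_ (fun x h => h)) /andP[F1 F2].
have mass := riesz_mass_le r2 a0 dp eta1 eps0 ds small uF.
set A := 2 / alpha in mass.
have A0 : 0 < A by rewrite divr_gt0.
have lnA : ln A = S * ln 2 by rewrite /S /logb divfK// gt_eqF// ln_gt0// ltr1n.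
have up : \sum_(x <- F) mu x * ln (riesz s x) <= ln A - 1 + 100^-1 + (1 + 100^-1).
  apply: (@le_trans _ _ (\sum_(x <- F) (mu x * (ln A - 1) + A^-1 * (mu x * riesz s x)))).
    apply: ler_sum => x _; rewrite [A^-1 * _]mulrCA -mulrDr ler_wpM2l//.
    have := @le_ln1Dx R (A^-1 * riesz s x - 1); rewrite [1 + (_ - _)]addrC subrK.
    have y0 : 0 < A^-1 * riesz s x by rewrite mulr_gt0 ?invr_gt0 ?riesz_gt0.
    rewrite ltrBrDl subrr => /(_ y0); rewrite lnM ?posrE ?invr_gt0 ?riesz_gt0// lnV//.
    move: (ln A) (ln _) (A^-1 * _); clear => u v w h; lra.
  rewrite big_split/= -mulr_suml -mulr_sumr.
  have h : A^-1 * \sum_(x <- F) mu x * riesz s x <= 1 + 100^-1.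
    by rewrite ler_pdivrMl// mulrC.
  have lA0 : 0 <= ln A by rewrite lnA mulr_ge0 ?ln_ge0 ?ler1n.
  apply: lerD => //; move: (\sum_(x <- F) mu x) (ln A) F1 F2 lA0; clear => M l F1 F2 l0.
  nra.
(* The mean of a wave over [F] is at least the mass of [F] minus 1/3, hence at least
   [2 / 3 - 1 / 100]. *)
have low : (size s)%:R * (8^-1 * (2 / 3 - 100^-1) - 56^-1) <= \sum_(x <- F) mu x * ln (riesz s x).
  apply: (@le_trans _ _ (\sum_(x <- F) mu x * \sum_(z <- s) (8^-1 * wave z.2 z.1 x - 56^-1))); last first.
    by apply: ler_sum => x _; rewrite ler_wpM2l// ln_riesz_ge.
  under eq_bigr => x _ do rewrite mulr_sumr.
  rewrite exchange_big/= -sum1_size natr_sum mulr_suml big_seq [leRHS]big_seq.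
  apply: ler_sum => z zs; rewrite mul1r.
  have h := near z zs F uF.
  have e1 : \sum_(x <- F) mu x * (1 - wave z.2 z.1 x)
      = \sum_(x <- F) mu x - \sum_(x <- F) mu x * wave z.2 z.1 x.
    by rewrite -sumrB; apply: eq_bigr => x _; rewrite mulrBr mulr1.
  have e2 : \sum_(x <- F) mu x * (8^-1 * wave z.2 z.1 x - 56^-1)
      = 8^-1 * \sum_(x <- F) mu x * wave z.2 z.1 x - (\sum_(x <- F) mu x) * 56^-1.
    rewrite mulr_sumr mulr_suml -sumrB; apply: eq_bigr => x _.
    by rewrite mulrBr mulrCA.
  rewrite e1 in h; rewrite e2.
  move: (\sum_(x <- F) mu x) (\sum_(x <- F) mu x * _) h F1 F2; clear => M w h F1 F2.
  lra.
rewrite leNgt; apply/negP => gt.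
by rewrite lnA in up; exact: arith S1 gt (ln2_le R) up low.
Qed.

Lemma dissociated_drop (R : realType) (n k : nat) (eps : R) (s : seq (torus R n * R)) :
  dissociated eps s -> dissociated eps (drop k s).
Proof. by elim: s k => [|z s IH] [|k]//= [ds _]; exact: IH. Qed.

(** The previous bound forbids lengths in [(13 S, 14 S]], which contains an integer since [S >= 1];
    a longer sequence would have a dissociated tail of such a length. *)
Lemma dissociated_size (R : realType) (n : nat) (r alpha : R)
    (mu : 'rV[int]_n -> R) (s : seq (torus R n * R)) :
  2 <= r -> 0 < alpha -> alpha <= 1 -> dense_piece alpha mu (gamma r) ->
  let S := logb 2 (2 / alpha) in
  (forall z, z \in s -> forall F, uniq F ->
     \sum_(x <- F) mu x * (1 - wave z.2 z.1 x) <= 3^-1) ->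
  dissociated (5 * Num.sqrt S / r) s ->
  (size s)%:R <= 14 * S.
Proof.
move=> r2 a0 a1 dp S near ds; have S1 : 1 <= S := logb2_ge1 a0 a1.
rewrite leNgt; apply/negP => gt.
pose M := (Num.truncn (13 * S)).+1.
have S13 : 0 <= 13 * S by rewrite mulr_ge0// (le_trans ler01).
have /andP[M1 M2] := truncn_itv S13; rewrite -/M in M2.
have M14 : M%:R <= 14 * S.
  have -> : M%:R = (Num.truncn (13 * S))%:R + 1 :> R by rewrite natr1.
  move: (Num.truncn _)%:R M1 => t M1; clear -M1 S1; clearbody S; lra.
have Ms : (M <= size s)%N by rewrite -(ler_nat R) (le_trans M14)// ltW.
have := dissociated_size_gap (s := drop (size s - M) s) r2 a0 a1 dp _ (dissociated_drop _ ds).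
rewrite size_drop subKn// => /(_ _ M14) h.
have : M%:R <= 13 * S by apply: h => z /mem_drop zs; exact: near.
by rewrite leNgt M2.
Qed.

(** * Subgroups described by mixed-radix expansions *)

(** The sequences [t] and [k] are total, so adjoining a generator only changes values from index [m]
    on. *)
Definition tower_elt (V : zmodType) (t : nat -> V) (k : nat -> nat) (m : nat) (x : V) : Prop :=
  exists c : nat -> nat, (forall i, (i < m)%N -> (c i < k i)%N) /\
    x = \sum_(i < m) t i *+ c i.

Definition tower (V : zmodType) (t : nat -> V) (k : nat -> nat) (m : nat) : Prop :=
  forall j, (j < m)%N -> (0 < k j)%N /\ tower_elt t k j (t j *+ k j).

Lemma tower_elt_ext (V : zmodType) (t t' : nat -> V) (k k' : nat -> nat) (m : nat) x :
  (forall i, (i < m)%N -> t i = t' i /\ k i = k' i) ->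
  tower_elt t k m x -> tower_elt t' k' m x.
Proof.
move=> e [c [ck ->]]; exists c; split=> [i im|].
  by have [_ <-] := e i im; exact: ck.
by apply: eq_bigr => i _; have [->] := e i (ltn_ord i).
Qed.

Definition subgroup (V : zmodType) (H : V -> Prop) : Prop :=
  H 0 /\ forall x y, H x -> H y -> H (x - y).

Lemma subgroupN (V : zmodType) (H : V -> Prop) x : subgroup H -> H x -> H (- x).
Proof. by move=> [H0 HB] Hx; rewrite -sub0r; exact: HB. Qed.

Lemma subgroupD (V : zmodType) (H : V -> Prop) x y : subgroup H -> H x -> H y -> H (x + y).
Proof. by move=> sH Hx Hy; rewrite -[y]opprK; apply: sH.2 => //; exact: subgroupN. Qed.

Lemma subgroupMn (V : zmodType) (H : V -> Prop) x c : subgroup H -> H x -> H (x *+ c).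
Proof.
move=> sH Hx; elim: c => [|c IH]; first by rewrite mulr0n; exact: sH.1.
by rewrite mulrS; exact: subgroupD.
Qed.

(** A carry: the quotient of [C] by [k m] moves into the lower subgroup and the remainder is the new
    digit. *)
Lemma tower_elt_add (V : zmodType) (t : nat -> V) (k : nat -> nat) (m C : nat) h :
  subgroup (tower_elt t k m) -> (0 < k m)%N -> tower_elt t k m (t m *+ k m) ->
  tower_elt t k m h -> tower_elt t k m.+1 (h + t m *+ C).
Proof.
move=> sH k0 tk Hh.
have [c [ck cE]] := subgroupD sH Hh (subgroupMn (C %/ k m) sH tk).
exists (fun i => if (i < m)%N then c i else (C %% k m)%N); split=> [i|].
  rewrite ltnS leq_eqVlt => /predU1P[->|im]; first by rewrite ltnn ltn_pmod.
  by rewrite im ck.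
rewrite big_ord_recr/= ltnn {1}(divn_eq C (k m)) mulrnDr mulnC mulrnA addrA cE.
by congr (_ + _); apply: eq_bigr => i _; rewrite ltn_ord.
Qed.

Lemma tower_subgroup (V : zmodType) (t : nat -> V) (k : nat -> nat) (m : nat) :
  tower t k m -> subgroup (tower_elt t k m).
Proof.
elim: m => [|m IH] tow.
  split=> [|x y [c [_ ->]] [d [_ ->]]]; first by exists (fun=> 0%N); rewrite big_ord0.
  by exists (fun=> 0%N); rewrite !big_ord0 subrr.
have sH := IH (fun j jm => tow j (ltnW jm)).
have [k0 tk] := tow m (ltnSn m).
have dec x : tower_elt t k m.+1 x -> exists h c, tower_elt t k m h /\ x = h + t m *+ c.
  move=> [c [ck ->]]; exists (\sum_(i < m) t i *+ c i), (c m); rewrite big_ord_recr.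
  by split=> //; exists c; split=> // i im; apply: ck; exact: ltnW.
split=> [|x y /dec[h [c [Hh ->]]] /dec[h' [c' [Hh' ->]]]].
  by rewrite -[0]addr0 -[X in _ + X](mulr0n (t m)); apply: tower_elt_add => //; exact: sH.1.
(* Negative multiples are made nonnegative modulo the lower subgroup:
   [- c' t = c' (k - 1) t - c' (k t)]. *)
have -> : h + t m *+ c - (h' + t m *+ c')
   = (h - h' - (t m *+ k m) *+ c') + t m *+ (c + c' * (k m).-1).
  have -> : (t m *+ k m) *+ c' = t m *+ (c' * (k m).-1) + t m *+ c'.
    by rewrite -mulrnDr -mulrnA; congr (_ *+ _); rewrite -mulnSr prednK// mulnC.
  rewrite mulrnDr; move: (_ *+ c) (_ *+ (_ * _)) (_ *+ c') => a b e.
  rewrite [b + e]addrC [a + b]addrC !opprD !addrA subrK.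
  by rewrite (addrAC h a) (addrAC _ a).
apply: tower_elt_add => //; apply: sH.2; last exact: subgroupMn.
exact: sH.2.
Qed.

(** * Recorded frequencies and the choice of the order and the level *)

Definition pow_sum (q l : nat) : nat := (\sum_(i < l) q ^ i)%N.

Lemma pow_sumS q l : pow_sum q l.+1 = (pow_sum q l + q ^ l)%N.
Proof. by rewrite /pow_sum big_ord_recr. Qed.

Lemma pow_sum_geom q l : (0 < q)%N -> (pow_sum q l * q.-1).+1 = (q ^ l)%N.
Proof.
move=> q0; elim: l => [|l IH]; first by rewrite /pow_sum big_ord0.
by rewrite pow_sumS mulnDl -addSn IH -mulnS prednK// expnSr.
Qed.

(** A power of [q] minus any combination of the smaller powers stays above [q - 2], where the search
    for the order [k] starts. *)
Lemma pow_sum_gap q l : (2 < q)%N -> (pow_sum q l.+1 + q.-1 <= q ^ l.+1)%N.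
Proof.
move=> q2; elim: l => [|l IH].
  by rewrite pow_sumS /pow_sum big_ord0 expn0 expn1; lia.
rewrite pow_sumS [X in (_ <= X)%N]expnS; have := IH; move: (pow_sum _ _) (q ^ _)%N => a b ab.
have : (2 * b <= q * b)%N by rewrite leq_mul2r (ltnW q2) orbT.
lia.
Qed.

(** The largest power comes first, so [dissociated] compares it with combinations of the smaller
    ones; the phase is scaled along so that [wave_mulrn] applies. *)
Fixpoint add_freqs (R : realType) (n : nat) (s : torus R n) (phi : R) (q l : nat)
    (fr : seq (torus R n * R)) : seq (torus R n * R) :=
  if l is l'.+1 then (s *+ q ^ l', phi *+ q ^ l') :: add_freqs s phi q l' fr else fr.

Lemma size_add_freqs (R : realType) (n : nat) (s : torus R n) (phi : R) (q l : nat) fr :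
  size (add_freqs s phi q l fr) = (l + size fr)%N.
Proof. by elim: l => //= l ->. Qed.

Lemma cube_add_freqs (R : realType) (n : nat) (s : torus R n) (phi : R) (q l : nat) fr w :
  cube (add_freqs s phi q l fr) w ->
  exists a b w', [/\ w = s *+ a - s *+ b + w', (a + b <= pow_sum q l)%N & cube fr w'].
Proof.
elim: l w => [|l IH] w /=.
  by move=> cw; exists 0%N, 0%N, w; rewrite mulr0n subrr add0r.
rewrite pow_sumS; case=> /IH[a [b [w' [wE ab cw']]]].
- by exists a, b, w'; split=> //; lia.
- exists (a + q ^ l)%N, b, w'; split=> //; last by lia.
  by rewrite -[w](subrK (s *+ q ^ l)) wE mulrnDr addrAC -!addrA; congr (_ + _); rewrite addrCA addrA.
- exists a, (b + q ^ l)%N, w'; split=> //; last by lia.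
  by rewrite -[w](addrK (s *+ q ^ l)) wE mulrnDr opprD addrAC !addrA.
Qed.

Lemma add_freqs_near (R : realType) (n : nat) (mu : 'rV[int]_n -> R) (K : R)
    (s : torus R n) (phi : R) (q l : nat) fr :
  (forall x, 0 <= mu x) -> 0 < K ->
  (forall F, uniq F -> \sum_(x <- F) mu x * (1 - wave phi s x) <= K^-1) ->
  (forall i, (i < l)%N -> 3 * (q ^ i)%:R ^+ 2 <= K) ->
  (forall z, z \in fr -> forall F, uniq F -> \sum_(x <- F) mu x * (1 - wave z.2 z.1 x) <= 3^-1) ->
  forall z, z \in add_freqs s phi q l fr -> forall F, uniq F ->
    \sum_(x <- F) mu x * (1 - wave z.2 z.1 x) <= 3^-1.
Proof.
move=> mu0 K0 near; elim: l => [|l IH] qK nfr //= z.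
rewrite inE => /predU1P[->|]; last by apply: IH => // i il; apply: qK; exact: ltnW.
move=> F uF /=.
apply: (@le_trans _ _ (\sum_(x <- F) (q ^ l)%:R ^+ 2 * (mu x * (1 - wave phi s x)))).
  apply: ler_sum => x _; rewrite mulrCA ler_wpM2l// wave_mulrn.
  exact: one_subr_cos_mulrn.
rewrite -mulr_sumr; apply: (@le_trans _ _ ((q ^ l)%:R ^+ 2 * K^-1)).
  by rewrite ler_wpM2l ?sqr_ge0 ?near.
by rewrite ler_pdivrMr// ler_pdivlMl// qK.
Qed.

(** At [k = Q] the tolerance [k * eta] is at least the largest possible torus norm, so a good order
    exists; take the least. *)
Lemma min_approx_order (R : realType) (n : nat) (H : torus R n -> Prop) (s : torus R n)
    (E eta : R) (a Q : nat) :
  H 0 -> (a <= Q)%N -> Num.sqrt n%:R / 2 <= Q%:R * eta ->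
  exists k h, [/\ (a <= k <= Q)%N, H h,
    torus_norm (s *+ k - h) <= Num.max E (k%:R * eta) &
    forall c, (a <= c < k)%N -> forall h', H h' -> E < torus_norm (s *+ c - h')].
Proof.
move=> H0 aQ nQ.
pose good k := (a <= k <= Q)%N &&
  `[< exists h, H h /\ torus_norm (s *+ k - h) <= Num.max E (k%:R * eta) >].
have ex : exists k, good k.
  exists Q; rewrite /good aQ leqnn/=; apply/asboolP; exists 0; split=> //.
  by rewrite subr0 le_max (le_trans (torus_norm_ub _) nQ) orbT.
case: (ex_minnP ex) => k /andP[/andP[ak kQ]] /asboolP[h [Hh hk]] kmin.
exists k, h; split=> //; first by rewrite ak.
move=> c /andP[ac ck] h' Hh'; rewrite ltNge; apply/negP => le.
have : good c.
  rewrite /good ac (leq_trans (ltnW ck) kQ)/=; apply/asboolP; exists h'; split=> //.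
  by rewrite le_max le.
by move=> /kmin; rewrite leqNgt ck.
Qed.

(** Take the largest admissible [L], with [L = 1] always allowed since [k] may be below [q]; one of
    the two constraints then fails at [L + 1]. *)
Lemma max_freq_level (R : realType) (K : R) (q k : nat) : (1 < q)%N ->
  exists L, [/\ (0 < L)%N, L = 1%N \/ (q ^ L <= k)%N /\ (q ^ (2 * L).-1)%:R <= K &
    (k < q ^ L.+1)%N \/ K < (q ^ (2 * L).+1)%:R].
Proof.
move=> q1.
pose P L := (L == 1%N) || [&& (0 < L)%N, (q ^ L <= k)%N & (q ^ (2 * L).-1)%:R <= K].
have exP : exists L, P L by exists 1%N.
have ub L : P L -> (L <= maxn 1 k)%N.
  move=> /orP[/eqP->|/and3P[_ qk _]]; first exact: leq_maxl.
  rewrite leq_max; apply/orP; right; apply: leq_trans qk.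
  exact/ltnW/ltn_expl.
case: (ex_maxnP exP ub) => L PL Lmax; exists L; split.
- by case/orP: PL => [/eqP->|/and3P[]].
- by case/orP: PL => [/eqP->|/and3P[_ ? ?]]; [left|right].
- case: (ltnP k (q ^ L.+1)) => [|kq]; first by left.
  right; rewrite ltNge; apply/negP => qK.
  have : P L.+1 by rewrite /P kq (_ : (2 * L.+1).-1 = (2 * L).+1)%N ?qK ?orbT//; lia.
  by move=> /Lmax; rewrite ltnn.
Qed.

(** Subtract from [s] the [k]-th part of a shortest representative of the defect [k s - h]. *)
Lemma torus_divide (R : realType) (n k : nat) (s h : torus R n) : (0 < k)%N ->
  exists t : torus R n, t *+ k = h /\
    k%:R * torus_norm (s - t) <= torus_norm (s *+ k - h).
Proof.
move=> k0; have [v [vE _ vn]] := torus_centered_repr (s *+ k - h).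
have kn : k%:R != 0 :> R by rewrite pnatr_eq0 -lt0n.
exists (s - tpi (k%:R^-1 *: v)); split.
  rewrite mulrnBl -tpiMn -scaler_nat scalerA divff// scale1r vE.
  by rewrite opprB addrC subrK.
rewrite opprB addrC subrK; apply: le_trans vn.
rewrite -ler_pdivlMl ?ltr0n//; apply: le_trans (torus_norm_le _) _.
by rewrite norm2Z ger0_norm// invr_ge0.
Qed.

(** Either [k < q ^ (L + 1) <= q ^ (3 L)], or [K < q ^ (2 L + 1) <= q ^ (3 L)] and
    [k <= Q = K ^ (log_K Q)]. *)
Lemma step_factor_le (R : realType) (K : R) (q k L Q : nat) :
  (1 < q)%N -> (0 < L)%N -> q%:R <= K -> (0 < k <= Q)%N ->
  (k < q ^ L.+1)%N \/ K < (q ^ (2 * L).+1)%:R ->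
  k%:R <= q%:R `^ (3 * L%:R * (1 + logb K Q%:R)).
Proof.
move=> q1 L0 qK /andP[k0 kQ].
have q1' : 1 <= q%:R :> R by rewrite ler1n ltnW.
have K1 : 1 < K by apply: lt_le_trans qK; rewrite ltr1n.
have Q1 : 1 <= Q%:R :> R by rewrite ler1n (leq_trans k0).
have ell0 : 0 <= logb K Q%:R by rewrite divr_ge0 ?ln_ge0// ltW.
have L3 : 0 <= 3 * L%:R :> R by rewrite mulr_ge0.
case=> [kq|Kq].
  apply: (@le_trans _ _ (q%:R `^ (3 * L)%:R)).
    by rewrite powR_mulrn// -natrX ler_nat (leq_trans (ltnW kq))// leq_exp2l//; lia.
  by apply: ler_powR => //; rewrite natrM ler_peMr// lerDl.
apply: (@le_trans _ _ Q%:R); first by rewrite ler_nat.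
rewrite [X in X <= _](_ : Q%:R = K `^ logb K Q%:R); last first.
  rewrite /powR gt_eqF ?(lt_trans ltr01)// /logb divfK ?lnK ?posrE ?(lt_le_trans ltr01)//.
  by rewrite gt_eqF// ln_gt0.
apply: (@le_trans _ _ ((q%:R `^ (3 * L%:R)) `^ logb K Q%:R)).
  apply: ge0_ler_powR; rewrite ?nnegrE ?powR_ge0 ?(le_trans ler01 (ltW K1))//.
  apply: le_trans (ltW Kq) _; rewrite -natrM powR_mulrn// -natrX ler_nat leq_exp2l//; lia.
by rewrite -powRrM; apply: ler_powR => //; rewrite ler_wpM2l// lerDr.
Qed.

(** * One greedy step *)

Definition near_const (R : realType) (n : nat) (mu : 'rV[int]_n -> R) (z : torus R n * R) : Prop :=
  forall F, uniq F -> \sum_(x <- F) mu x * (1 - wave z.2 z.1 x) <= 3^-1.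

(* [fr] lists the frequencies [q ^ l * s] contributed by the elements [s] of the
   spectrum chosen so far; the bound on the product of the [k j] and the
   termination of the iteration are both controlled by [size fr]. *)
Record tower_state (R : realType) (n : nat) (mu : 'rV[int]_n -> R) (q Q : nat)
    (ell eps lam : R) (m : nat) (t : nat -> torus R n) (k : nat -> nat)
    (fr : seq (torus R n * R)) : Prop := TowerState {
  state_tower : tower t k m;
  state_bound : forall j, (j < m)%N -> (k j <= Q)%N;
  state_size : (m <= size fr)%N;
  state_prod : (\prod_(j < m) k j)%:R <= q%:R `^ (3 * (size fr)%:R * (1 + ell));
  state_near : forall z, z \in fr -> near_const mu z;
  state_dissociated : dissociated eps fr;
  state_cube : forall w, cube fr w ->
    exists2 h, tower_elt t k m h & torus_norm (w - h) <= eps * lam ^+ m - eps }.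

(** A combination led by [q ^ l s] has the form [C s + w'], where [C s] is at distance at least [E]
    from [H] and [w'] within [E - eps] of it; the difference is [eps]. *)
Lemma add_freqs_dissociated (R : realType) (n : nat) (H : torus R n -> Prop)
    (s : torus R n) (phi : R) (q k L : nat) (eps E : R) fr :
  (2 < q)%N -> subgroup H ->
  (forall w, cube fr w -> exists2 h, H h & torus_norm (w - h) <= E - eps) ->
  (forall h, H h -> E <= torus_norm (s - h)) ->
  (forall c, (q - 2 <= c < k)%N -> forall h, H h -> E < torus_norm (s *+ c - h)) ->
  (L <= 1)%N \/ (q ^ L <= k)%N ->
  dissociated eps fr -> dissociated eps (add_freqs s phi q L fr).
Proof.
move=> q2 sH near far min Lk ds.
suff st l : (l <= L)%N -> dissociated eps (add_freqs s phi q l fr) by exact: st.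
elim: l => [|l IH] lL //=; split; first exact/IH/ltnW.
move=> w /cube_add_freqs[a [b [w' [-> ab cw']]]].
have [h Hh wh] := near w' cw'.
have [C [CE CH]] : exists C, s *+ q ^ l + (s *+ a - s *+ b + w') = s *+ C + w' /\
    E <= torus_norm (s *+ C - (- h)).
  have geom := pow_sum_geom l (ltnW (ltnW q2)).
  have bq : (b <= q ^ l + a)%N.
    have : (pow_sum q l * 1 <= pow_sum q l * q.-1)%N by rewrite leq_mul2l; lia.
    by lia.
  exists (q ^ l + a - b)%N; split.
    by rewrite mulrnBr// mulrnDr !addrA.
  (* For the power [q ^ 0] the multiple is 1 and [far] applies. Otherwise [C >= q - 1] by
     [pow_sum_gap], and [C < q ^ L <= k] by the geometric sum, so minimality of [k] applies. *)
  case: l => [|l] in lL ab bq IH geom *.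
    move: ab; rewrite /pow_sum big_ord0 leqn0 addn_eq0 => /andP[/eqP-> /eqP->].
    by rewrite expn0 addn0 subn0 mulr1n; apply: far; exact: subgroupN.
  apply/ltW/min; last exact: subgroupN.
  have qk : (q ^ L <= k)%N by case: Lk => // L1; lia.
  have gap := pow_sum_gap l q2.
  have geom2 := pow_sum_geom l.+2 (ltnW (ltnW q2)).
  have : (pow_sum q l.+2 * 1 <= pow_sum q l.+2 * q.-1)%N by rewrite leq_mul2l; lia.
  have : (q ^ l.+2 <= q ^ L)%N by rewrite leq_exp2l// ltnW.
  rewrite [pow_sum q l.+2]pow_sumS in geom2 *.
  move: (pow_sum _ _) (q ^ l.+1)%N (q ^ l.+2)%N (q ^ L)%N qk gap geom2 ab bq.
  move=> G A B D qk gap geom2 ab bq DB GG.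
  by apply/andP; split; lia.
rewrite CE; have := torus_normD (s *+ C + w') (- (w' - h)); rewrite torus_normN.
have -> : s *+ C + w' - (w' - h) = s *+ C - (- h).
  by rewrite opprK opprB -addrA [w' + _]addrC subrK.
by move: (torus_norm _) (torus_norm _) (torus_norm _) CH wh; clear => x y z; lra.
Qed.

(** If [D <= E], use [G (q - 2) <= k] and [k d <= E]; if [D <= k eta], then [d <= eta], and
    [G (q - 2) <= K] with [eta K <= E] concludes. *)
Lemma loss_le (R : realType) (G q k : nat) (E K eta D d : R) :
  (2 < q)%N -> (0 < k)%N -> 0 <= eta -> 0 <= d -> 0 <= E -> eta * K <= E ->
  (G * (q - 2) <= k)%N -> (G * (q - 2))%:R <= K ->
  k%:R * d <= D -> D <= Num.max E (k%:R * eta) ->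
  G%:R * d <= E / (q%:R - 2).
Proof.
move=> q2 k0 eta0 d0 E0 etaK Gk GK kd dm.
have k0' : 0 < k%:R :> R by rewrite ltr0n.
have q2' : 0 < q%:R - 2 :> R by rewrite subr_gt0 ltr_nat.
rewrite ler_pdivlMr// mulrAC -(natrB _ (ltnW q2)) -natrM.
move: (G * (q - 2))%N Gk GK => g gk gK.
have gk' : g%:R <= k%:R :> R by rewrite ler_nat.
have g0 : 0 <= g%:R :> R by [].
move: (le_trans kd dm); rewrite le_max => /orP[h|].
  apply: le_trans h; exact: ler_wpM2r.
rewrite ler_pM2l// => h; apply: le_trans etaK; rewrite mulrC.
by apply: ler_pM.
Qed.

(* [k] is the least order at which a multiple of [s] returns close to the
   subgroup; moving [s] by [1 / k] of the defect makes this exact. *)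
Lemma tower_step (R : realType) (n : nat) (mu : 'rV[int]_n -> R) (q Q : nat)
    (K eps eta phi : R) (m : nat) (t : nat -> torus R n) (k : nat -> nat) fr (s : torus R n) :
  let lam := (q%:R - 1) / (q%:R - 2) in
  (2 < q)%N -> q%:R <= K -> 0 < eps -> 0 <= eta -> eta * K <= eps ->
  Num.sqrt n%:R / 2 <= Q%:R * eta -> (q <= Q)%N -> (forall x, 0 <= mu x) ->
  (forall F, uniq F -> \sum_(x <- F) mu x * (1 - wave phi s x) <= K^-1) ->
  tower_state mu q Q (logb K Q%:R) eps lam m t k fr ->
  (forall h, tower_elt t k m h -> eps * lam ^+ m <= torus_norm (s - h)) ->
  exists t' k' fr', tower_state mu q Q (logb K Q%:R) eps lam m.+1 t' k' fr' /\
    (size fr < size fr')%N.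
Proof.
move=> lam q2 qK eps0 eta0 etaK nQ qQ mu0 ph [tow bd sz pr nr ds cb] far.
have sH := tower_subgroup tow.
have q2' : 0 < q%:R - 2 :> R by rewrite subr_gt0 ltr_nat.
have lamE : lam = 1 + (q%:R - 2)^-1.
  by rewrite /lam; move: (q%:R) q2'; clear => x x2; field; rewrite lt0r_neq0.
have lam1 : 1 <= lam by rewrite lamE lerDl invr_ge0 ltW.
set E := eps * lam ^+ m in far cb.
have epsE : eps <= E by rewrite /E ler_peMr ?(ltW eps0)// exprn_ege1.
have E0 : 0 <= E by apply: le_trans epsE; exact: ltW.
(* Starting at [q - 2] ensures [q - 2 <= kk], which the loss bound needs in the case [L = 1]. *)
have [kk [h0 [/andP[ka kQ] Hh0 hk kmin]]] :=
  @min_approx_order R n (tower_elt t k m) s E eta (q - 2) Q sH.1 (leq_trans (leq_subr _ _) qQ) nQ.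
have kk0 : (0 < kk)%N by apply: leq_trans ka; rewrite subn_gt0.
have [tn [tnE tnd]] := torus_divide s h0 kk0.
have [L [L0 Lk Lmax]] := max_freq_level K kk (ltnW q2).
have K0 : 0 < K by apply: lt_le_trans qK; rewrite ltr0n (ltnW (ltnW q2)).
pose t' i := if (i < m)%N then t i else tn.
pose k' i := if (i < m)%N then k i else kk.
have ext j x : (j <= m)%N -> tower_elt t k j x -> tower_elt t' k' j x.
  move=> jm; apply: tower_elt_ext => i ij.
  by rewrite /t' /k' (leq_trans ij jm).
have t'm : t' m = tn by rewrite /t' ltnn.
have k'm : k' m = kk by rewrite /k' ltnn.
have tow' : tower t' k' m.+1.
  move=> j; rewrite ltnS leq_eqVlt => /predU1P[->|jm].
    by rewrite t'm k'm tnE; split=> //; exact: ext.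
  have [kj tj] := tow j jm; rewrite /t' /k' jm; split=> //.
  by rewrite -/t' -/k'; apply: ext => //; exact: ltnW.
have geom := pow_sum_geom L (ltnW (ltnW q2)).
have Gq : (pow_sum q L * (q - 2) <= pow_sum q L * q.-1)%N.
  by rewrite leq_mul2l -[q.-1]subn1 leq_sub2l// orbT.
have Gk : (pow_sum q L * (q - 2) <= kk)%N.
  case: Lk => [->|[qk _]]; last by clear -Gq geom qk; lia.
  by rewrite pow_sumS /pow_sum big_ord0 expn0 mul1n.
have GK : (pow_sum q L * (q - 2))%:R <= K.
  case: Lk => [->|[_ qLK]].
    apply: le_trans qK; rewrite pow_sumS /pow_sum big_ord0 expn0 mul1n ler_nat.
    exact: leq_subr.
  apply: le_trans qLK; rewrite ler_nat; apply: (@leq_trans (q ^ L)); first by clear -Gq geom; lia.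
  by rewrite leq_exp2l ?(ltnW q2)//; clear -L0; lia.
exists t', k', (add_freqs s phi q L fr); split; last first.
  by rewrite size_add_freqs -addn1 addnC leq_add2r.
split=> //.
- move=> j; rewrite ltnS leq_eqVlt => /predU1P[->|jm]; first by rewrite k'm.
  by rewrite /k' jm bd.
- by rewrite size_add_freqs -addn1 addnC leq_add.
- rewrite big_ord_recr/= k'm natrM size_add_freqs.
  have -> : (\prod_(i < m) k' i)%N = (\prod_(i < m) k i)%N.
    by apply: eq_bigr => i _; rewrite /k' ltn_ord.
  have -> : 3 * (L + size fr)%:R * (1 + logb K Q%:R)
     = 3 * (size fr)%:R * (1 + logb K Q%:R) + 3 * L%:R * (1 + logb K Q%:R).
    by rewrite natrD; move: (logb _ _) L%:R (size fr)%:R => x y z; clear; ring.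
  rewrite powRD; last by rewrite pnatr_eq0 -lt0n (ltnW (ltnW q2)) implybT.
  apply: ler_pM => //; apply: step_factor_le => //; first exact: ltnW.
  by rewrite kk0.
(* For [i < L], [3 q ^ (2 i) <= q ^ (2 i + 1) <= q ^ (2 L - 1) <= K]: hence the exponent in the
   choice of [L]. *)
- apply: (@add_freqs_near _ _ mu K) => // i iL.
  case: Lk => [L1|[_ qLK]].
    have -> : i = 0%N by clear -iL L1; lia.
    by rewrite expn0 expr1n mulr1 (le_trans _ qK)// ler_nat.
  apply: le_trans qLK; rewrite -natrX -natrM ler_nat -expnM.
  apply: (@leq_trans (q ^ (i * 2).+1)); first by rewrite expnS leq_mul2r q2 orbT.
  by rewrite leq_exp2l ?(ltnW q2)//; clear -iL; lia.
- apply: (@add_freqs_dissociated _ _ (tower_elt t k m) s phi q kk L eps E) => //.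
  by case: Lk => [->|[]]; [left|right].
- move=> w /cube_add_freqs[a [b [w' [-> ab cw']]]].
  have [h Hh wh] := cb w' cw'.
  have sH' := tower_subgroup tow'.
  have tnH : tower_elt t' k' m.+1 tn.
    have := @tower_elt_add _ t' k' m 1 0; rewrite add0r mulr1n t'm k'm; apply=> //.
    + by apply: tower_subgroup => j jm; apply: tow'; exact: ltnW.
    + by rewrite tnE; exact: ext.
    + by apply: ext => //; exact: sH.1.
  have hH : tower_elt t' k' m.+1 h.
    have := @tower_elt_add _ t' k' m 0 h; rewrite mulr0n addr0 t'm k'm; apply=> //.
    + by apply: tower_subgroup => j jm; apply: tow'; exact: ltnW.
    + by rewrite tnE; exact: ext.
    + exact: ext.
  exists (tn *+ a - tn *+ b + h).
    apply: subgroupD => //; apply: sH'.2; exact: subgroupMn.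
  have -> : s *+ a - s *+ b + w' - (tn *+ a - tn *+ b + h)
     = ((s - tn) *+ a + - ((s - tn) *+ b)) + (w' - h).
    by rewrite !mulrnBl !opprD !opprK addrACA; congr (_ + _); rewrite addrACA.
  apply: le_trans (torus_normD _ _) _.
  apply: le_trans (lerD (torus_normD _ _) (lexx _)) _; rewrite torus_normN.
  have na := torus_norm_mulrn a (s - tn); have nb := torus_norm_mulrn b (s - tn).
  have d0 := torus_norm_ge0 (s - tn).
  have loss := loss_le q2 kk0 eta0 d0 E0 (le_trans etaK epsE) Gk GK tnd hk.
  have abG : (a%:R + b%:R) * torus_norm (s - tn) <= (pow_sum q L)%:R * torus_norm (s - tn).
    by rewrite ler_wpM2r// -natrD ler_nat.
  (* As [lam = 1 + 1 / (q - 2)], the radius grows by exactly the loss allowed for replacing [s] by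
     [tn]. *)
  have lE : eps * lam ^+ m.+1 = E + E / (q%:R - 2).
    by rewrite exprSr mulrA -/E lamE mulrDr mulr1.
  rewrite lE [E + _]addrC -[leRHS]addrA; apply: lerD => //.
  apply: le_trans (lerD na nb) _; rewrite -mulrDl.
  exact: le_trans abG loss.
Qed.

(** * Running the construction until the spectrum is covered *)

Theorem theorem4p3p2 (R : realType) (n : nat) (r alpha : R)
    (mu : 'rV[int]_n -> R) (q : int) (K : R) (Q : nat) :
  2 <= r -> 0 < alpha -> alpha <= 1 ->
  dense_piece alpha mu (gamma r) ->
  3 <= q -> q%:~R <= K ->
  (0 < Q)%N -> r * K * Num.sqrt n%:R <= Q%:R ->
  let S : R := logb 2 (2 / alpha) in
  let lambda_q : R := (q%:~R - 1) / (q%:~R - 2) in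
  exists (m : nat) (t : 'I_m -> torus R n) (k : 'I_m -> nat),
    [/\ forall j, (1 <= k j <= Q)%N,
        m%:R <= 14 * S,
        (\prod_(j < m) k j)%:R <= q%:~R `^ (56 * S * (1 + logb K Q%:R)),
        forall j : 'I_m, exists c : 'I_m -> nat,
          (forall i : 'I_m, (i < j)%N -> (c i < k i)%N) /\
          t j *+ k j = \sum_(i < m | (i < j)%N) t i *+ c i
      & forall s : torus R n, Lambda K mu s ->
          exists c : 'I_m -> nat,
            (forall i, (c i < k i)%N) /\
            torus_norm (s - \sum_(i < m) t i *+ c i)
              <= 5 * lambda_q `^ (14 * S) * Num.sqrt S / r].
Proof.
move=> r2 a0 a1 dp q3 qK Q0 rKQ S.
have [qn qE q2] : exists2 qn : nat, q = qn & (2 < qn)%N.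
  by exists (absz q); lia.
rewrite {q q3}qE in qK *; rewrite -pmulrn in qK *; move=> lambda_q.
have S1 : 1 <= S := logb2_ge1 a0 a1.
have S0 : 0 <= S by exact: le_trans ler01 S1.
have r0 : 0 < r by apply: lt_le_trans r2.
have K1 : 1 <= K by apply: le_trans qK; rewrite ler1n; lia.
have K0 : 0 < K by exact: lt_le_trans ltr01 K1.
pose eps := 5 * Num.sqrt S / r.
have sS1 : 1 <= Num.sqrt S by rewrite -sqrtr1 ler_wsqrtr.
have eps0 : 0 < eps by rewrite divr_gt0 ?mulr_gt0// (lt_le_trans ltr01).
(* [Q * eta] equals the bound [sqrt n / 2] on the torus norm, and [Q >= r K sqrt n] gives
   [eta * K <= 1 / (2 r) <= eps]. *)
pose eta := Num.sqrt n%:R / 2 / Q%:R : R.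
have Q0' : 0 < Q%:R :> R by rewrite ltr0n.
have sn0 : 0 <= Num.sqrt n%:R :> R by exact: sqrtr_ge0.
have eta0 : 0 <= eta by rewrite !divr_ge0.
have etaK : eta * K <= eps.
  have -> : eta * K = 2^-1 * (r * K * Num.sqrt n%:R) / Q%:R / r.
    rewrite /eta; move: (Num.sqrt _) Q%:R Q0' => u v v0; clear -v0 r0.
    by field; rewrite !lt0r_neq0.
  rewrite /eps ler_pM2r ?invr_gt0// ler_pdivrMr//.
  apply: ler_pM; rewrite ?mulr_ge0 ?invr_ge0 ?(ltW r0) ?(ltW K0)//.
  by clear -sS1; move: (Num.sqrt _) sS1 => x; lra.
have nQ : Num.sqrt n%:R / 2 <= Q%:R * eta by rewrite /eta [leRHS]mulrC divfK ?gt_eqF.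
have [mu0 mu1] := dp.1.
have ell0 : 0 <= logb K Q%:R by rewrite divr_ge0 ?ln_ge0// ler1n.
pose st := tower_state mu qn Q (logb K Q%:R) eps lambda_q.
have size14 m t k fr : st m t k fr -> (size fr)%:R <= 14 * S.
  by move=> h; exact: dissociated_size r2 a0 a1 dp (state_near h) (state_dissociated h).
pose done m (t : nat -> torus R n) k := forall s, Lambda K mu s ->
  exists2 h, tower_elt t k m h & torus_norm (s - h) <= eps * lambda_q ^+ m.
(* Each step not yet done adds a frequency; since [size fr <= 14 * S], a large [N] leaves only the
   alternative [done]. *)
have loop N : exists m t k fr, st m t k fr /\ (done m t k \/ (N <= size fr)%N).
  elim: N => [|N [m [t [k [fr [h [d|Nf]]]]]]].
  - exists 0%N, (fun=> 0), (fun=> 0%N), [::]; split; last by right.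
    split=> //; first by rewrite big_ord0 mulr0 mul0r powRr0.
    move=> w /= ->; exists 0; first by exists (fun=> 0%N); rewrite big_ord0.
    by rewrite subrr torus_norm0 expr0 mulr1 subrr.
  - by exists m, t, k, fr; split=> //; left.
  have [d|] := pselect (done m t k); first by exists m, t, k, fr; split=> //; left.
  move=> /existsNP[s /not_implyP[Ls nd]].
  have far h' : tower_elt t k m h' -> eps * lambda_q ^+ m <= torus_norm (s - h').
    by move=> Hh'; rewrite leNgt; apply/negP => /ltW lt; apply: nd; exists h'.
  have [phi ph] := Lambda_phase dp.1 Ls.
  have q2' : 0 < qn%:R - 2 :> R by rewrite subr_gt0 ltr_nat.
  have lam1 : 1 <= lambda_q.
    by rewrite /lambda_q ler_pdivlMr// mul1r lerD2l lerN2 ler1n.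
  have qQ : (qn <= Q)%N.
    rewrite -(ler_nat R); apply: le_trans qK _; apply: le_trans rKQ.
    (* In dimension 0 every torus norm is 0, against [far]; so [sqrt n >= 1] and [q <= K <= Q]. *)
    have n0 : (0 < n)%N.
      rewrite lt0n; apply/negP => /eqP n0.
      have := far 0 (tower_subgroup (state_tower h)).1.
      rewrite leNgt => /negP; apply; apply: le_lt_trans (torus_norm_ub _) _.
      by rewrite n0 sqrtr0 mul0r mulr_gt0// exprn_gt0// (lt_le_trans ltr01).
    have sn1 : 1 <= Num.sqrt n%:R :> R by rewrite -[leLHS]sqrtr1 ler_wsqrtr// ler1n.
    rewrite mulrAC -[leLHS]mul1r ler_pM2r// -[leLHS]mulr1 ler_pM//.
    by apply: le_trans r2; rewrite ler1n.
  have [t' [k' [fr' [h' sf]]]] := tower_step q2 qK eps0 eta0 etaK nQ qQ mu0 ph h far.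
  by exists m.+1, t', k', fr'; split=> //; right; exact: leq_ltn_trans Nf sf.
have [m [t [k [fr [h [d|big]]]]]] := loop (Num.truncn (14 * S)).+1; last first.
  have := size14 _ _ _ _ h; rewrite leNgt => /negP[].
  have /andP[_ lt] := truncn_itv (mulr_ge0 (ler0n R 14) S0).
  by apply: lt_le_trans lt _; rewrite ler_nat.
have m14 : m%:R <= 14 * S.
  by apply: le_trans (size14 _ _ _ _ h); rewrite ler_nat (state_size h).
have q2' : 0 < qn%:R - 2 :> R by rewrite subr_gt0 ltr_nat.
have lam1 : 1 <= lambda_q by rewrite /lambda_q ler_pdivlMr// mul1r lerD2l lerN2 ler1n.
have lam0 : 0 <= lambda_q by exact: le_trans ler01 lam1.
exists m, (fun i => t i), (fun i => k i); split=> //.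
- by move=> j; have [-> _] := state_tower h (ltn_ord j); rewrite (state_bound h).
(* The invariant gives the exponent [3 * 14 = 42], below 56. *)
- apply: le_trans (state_prod h) _; apply: ler_powR.
    by rewrite ler1n (ltnW (ltnW q2)).
  rewrite ler_wpM2r ?addr_ge0//.
  apply: (@le_trans _ _ (3 * (14 * S))); first by rewrite ler_pM2l// (size14 _ _ _ _ h).
  by rewrite mulrA -natrM ler_wpM2r// ler_nat.
- move=> j; have [_ [c [ck cE]]] := state_tower h (ltn_ord j).
  exists (fun i => c i); split=> [i ij|]; first exact: ck.
  rewrite cE (big_ord_widen m (fun i => t i *+ c i) (ltnW (ltn_ord j))).
  by apply: eq_bigl => i.
- move=> s /d[x [c [ck ->]] le]; exists (fun i => c i); split=> [i|]; first exact: ck.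
  apply: le_trans le _; rewrite /eps.
  have -> : 5 * lambda_q `^ (14 * S) * Num.sqrt S / r
     = 5 * Num.sqrt S / r * lambda_q `^ (14 * S).
    by rewrite -!mulrA; congr (_ * _); rewrite mulrC -!mulrA.
  rewrite ler_pM2l// -powR_mulrn//.
  exact: ler_powR.
Qed.
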